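(* Let $\mathcal{C},\mathcal{D}$ be pivotal 2-categories, and let $\iota:{**}_{\mathcal{D}}\to\mathrm{id}_{\mathcal{D}}$ be the pivotal structure on $\mathcal{D}$. Then the 2-category $\mathrm{Fun}_p(\mathcal{C},\mathcal{D})$ has a canonical structure of a pivotal 2-category. Its pivotal structure $\hat\iota:{**}\to\mathrm{id}$ assigns to every pseudonatural transformation $\alpha:F\to G$ the invertible modification $\hat\iota_\alpha:\alpha^{**}\to\alpha$ whose components are the 2-isomorphisms $\iota_{\alpha_r}:\alpha_r^{**}\to\alpha_r$ from the pivotal structure on $\mathcal{D}$.
   Context: All 2-categories are taken to be strict. 1-morphisms compose from left to right: for $X:r\to s$ and $Y:s\to t$ the composite is $X\otimes Y:r\to t$; $\otimes$ also denotes horizontal composition of 2-morphisms, and $\circ$ vertical composition. A pseudofunctor $F:\mathcal{C}\to\mathcal{D}$ consists of an assignment on objects, functors $\mathcal{C}(r,s)\to\mathcal{D}(F(r),F(s))$, and invertible 2-morphisms $m^F_{X,Y}:F(X)\otimes F(Y)\to F(X\otimes Y)$, $u^F_r:\mathrm{id}_{F(r)}\to F(\mathrm{id}_r)$ satisfying the usual naturality, associativity and unitality conditions. A pseudonatural transformation $\alpha:F\to G$ consists of 1-morphisms $\alpha_r:F(r)\to G(r)$ and invertible 2-morphisms $\alpha_X:F(X)\otimes\alpha_s\to\alpha_r\otimes G(X)$ for $X:r\to s$, such that $(\mathrm{id}_{\alpha_r}\otimes G(f))\circ\alpha_X=\alpha_Y\circ(F(f)\otimes\mathrm{id}_{\alpha_s})$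 for all $f:X\to Y$; $\alpha_{X\otimes Y}\circ(m^F_{X,Y}\otimes\mathrm{id}_{\alpha_t})=(\mathrm{id}_{\alpha_r}\otimes m^G_{X,Y})\circ(\alpha_X\otimes\mathrm{id}_{G(Y)})\circ(\mathrm{id}_{F(X)}\otimes\alpha_Y)$; and $\alpha_{\mathrm{id}_r}\circ(u^F_r\otimes\mathrm{id}_{\alpha_r})=\mathrm{id}_{\alpha_r}\otimes u^G_r$. It is an invertible icon if $F(r)=G(r)$ and $\alpha_r=\mathrm{id}_{F(r)}$ for all $r$. Composition: $(\alpha\otimes\beta)_r=\alpha_r\otimes\beta_r$, $(\alpha\otimes\beta)_X=(\mathrm{id}_{\alpha_r}\otimes\beta_X)\circ(\alpha_X\otimes\mathrm{id}_{\beta_s})$. A modification $f:\alpha\to\beta$ is a family $f_r:\alpha_r\to\beta_r$ with $\beta_X\circ(\mathrm{id}_{F(X)}\otimes f_s)=(f_r\otimes\mathrm{id}_{G(X)})\circ\alpha_X$. $\mathrm{Fun}(\mathcal{C},\mathcal{D})$ is the 2-category of pseudofunctors, pseudonatural transformations and modifications (composed componentwise). A right dual of $X:r\to s$ is $[X^*,\eta_X,\epsilon_X]$ with $X^*:s\to r$, $\eta_X:\mathrm{id}_s\to X^*\otimes X$, $\epsilon_X:X\otimes X^*\to\mathrm{id}_r$ satisfying the snake equations; a left dual is $[{}^*X,\eta,\epsilon]$ with $\eta:\mathrm{id}_r\to X\otimes{}^*X$, $\epsilon:{}^*X\otimes X\to\mathrm{id}_s$ satisfying the snake equations. The right transpose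 of $f:X\to Y$ is $f^*=(\mathrm{id}_{X^*}\otimes\epsilon_Y)\circ(\mathrm{id}_{X^*}\otimes f\otimes\mathrm{id}_{Y^*})\circ(\eta_X\otimes\mathrm{id}_{Y^*}):Y^*\to X^*$. Two right duals of the same 1-morphism are related by a unique 2-isomorphism compatible with the $\eta$'s and $\epsilon$'s (likewise left duals). In a 2-category with chosen right duals, the double duals pseudofunctor $**$ is the identity on objects and sends $X\mapsto X^{**}$, $f\mapsto f^{**}$, with multiplicators and unitors the canonical isomorphisms coming from uniqueness of duals. A 2-category with chosen right duals is pivotal if it is equipped with an invertible icon $\iota:{**}\to\mathrm{id}$ (the pivotal structure), i.e. 2-isomorphisms $\iota_X:X^{**}\to X$, natural in $X$ and compatible with composition and identities. In a pivotal 2-category, $X^*$ is also a left dual of $X$, with cup $(\iota_X\otimes\mathrm{id}_{X^*})\circ\eta_{X^*}:\mathrm{id}_r\to X\otimes X^*$ and cap $\epsilon_{X^*}\circ(\mathrm{id}_{X^*}\otimes\iota_X^{-1}):X^*\otimes X\to\mathrm{id}_s$; these are always taken as the chosen left duals. A pseudofunctor $F$ sends right duals to right duals: $F(X^* )$ is right dual to $F(X)$ with $(m^F_{X^*,X})^{-1}\circ F(\eta_X)\circ u^F_s$ and $(u^F_r)^{-1}\circ F(\epsilon_X)\circ m^F_{X,X^*}$; similarly for left duals. For $\mathcal{C},\mathcal{D}$ pivotal, comparing the induced right (resp. left) dual $F(X^* )$ with the chosen right (resp. left) dual $F(X)^*$ in $\mathcal{D}$ gives a unique compatible 2-isomorphism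 $F_r:F(X^* )\to F(X)^*$ (resp. $F_l:F(X^* )\to F(X)^*$). $F$ is called pivotal if $F_l=F_r$ for every $X$. $\mathrm{Fun}_p(\mathcal{C},\mathcal{D})\subset\mathrm{Fun}(\mathcal{C},\mathcal{D})$ is the sub-2-category whose objects are the pivotal pseudofunctors (with all pseudonatural transformations and modifications between them). Chosen right duals in $\mathrm{Fun}_p(\mathcal{C},\mathcal{D})$: $\alpha^*:G\to F$ has $(\alpha^* )_r=(\alpha_r)^*$, with duality modifications having components $\eta_{\alpha_r},\epsilon_{\alpha_r}$, and $(\alpha^* )_X:G(X)\otimes\alpha_s^*\to\alpha_r^*\otimes F(X)$ is the right transpose of $\alpha_{{}^*X}:F({}^*X)\otimes\alpha_r\to\alpha_s\otimes G({}^*X)$, where ${}^*X$ is the chosen left dual of $X$ in $\mathcal{C}$ and the right duals used are $F(X)$ for $F({}^*X)$ and $G(X)$ for $G({}^*X)$ (induced from $\mathcal{C}$) and $\alpha_r^*,\alpha_s^*$. *)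

(* Defs.v *)
From Stdlib Require Import ssreflect.
From Stdlib Require Import FunctionalExtensionality ProofIrrelevance ClassicalEpsilon.

Set Implicit Arguments.
Unset Strict Implicit.
Unset Printing Implicit Defensive.

Declare Scope tc_scope.
Delimit Scope tc_scope with tc.
Local Open Scope tc_scope.

Reserved Notation "X ⊗ Y" (at level 40, left associativity).
Reserved Notation "f ⋆ g" (at level 40, left associativity).
Reserved Notation "g ∘ f" (at level 50, left associativity).
Reserved Notation "X ⇒ Y" (at level 70, no associativity).

(* [X ⊗ Y] is the composite of 1-morphisms from left to right, [f ⋆ g] the
   horizontal and [g ∘ f] the vertical composite of 2-morphisms (first f). *)
Record TwoCatData := {
  Ob :> Type;
  Hom : Ob -> Ob -> Type;
  Cell : forall r s : Ob, Hom r s -> Hom r s -> Type;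
  id1 : forall r : Ob, Hom r r;
  tens : forall r s t : Ob, Hom r s -> Hom s t -> Hom r t;
  id2 : forall (r s : Ob) (X : Hom r s), Cell X X;
  vcomp : forall (r s : Ob) (X Y Z : Hom r s), Cell Y Z -> Cell X Y -> Cell X Z;
  hcomp : forall (r s t : Ob) (X X' : Hom r s) (Y Y' : Hom s t),
    Cell X X' -> Cell Y Y' -> Cell (tens X Y) (tens X' Y')
}.

Arguments Hom {t} r s : rename.
Arguments Cell {t r s} X Y : rename.
Arguments id1 {t} r : rename.
Arguments tens {t r s t0} X Y : rename.
Arguments id2 {t r s} X : rename.
Arguments vcomp {t r s X Y Z} g f : rename.
Arguments hcomp {t r s t0 X X' Y Y'} f g : rename.

Notation "X ⊗ Y" := (tens X Y) : tc_scope.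
Notation "f ⋆ g" := (hcomp f g) : tc_scope.
Notation "g ∘ f" := (vcomp g f) : tc_scope.
Notation "X ⇒ Y" := (Cell X Y) : tc_scope.

(* In a strict 2-category (X ⊗ Y) ⊗ Z and X ⊗ (Y ⊗ Z) are equal but not
   convertible; [cast e] is the identity 2-morphism read along such an
   equality e.  By proof irrelevance it does not depend on e. *)
Definition cast (C : TwoCatData) (r s : C) (X Y : Hom r s) (e : X = Y) : X ⇒ Y :=
  match e in _ = Z return X ⇒ Z with eq_refl => id2 X end.

Record TwoCat := {
  tc_data :> TwoCatData;
  vcompA : forall (r s : tc_data) (X Y Z W : Hom r s) (h : Z ⇒ W) (g : Y ⇒ Z) (f : X ⇒ Y),
    h ∘ (g ∘ f) = (h ∘ g) ∘ f;
  vcompL : forall (r s : tc_data) (X Y : Hom r s) (f : X ⇒ Y), id2 Y ∘ f = f;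
  vcompR : forall (r s : tc_data) (X Y : Hom r s) (f : X ⇒ Y), f ∘ id2 X = f;
  hcomp_id : forall (r s t : tc_data) (X : Hom r s) (Y : Hom s t),
    id2 X ⋆ id2 Y = id2 (X ⊗ Y);
  interchange : forall (r s t : tc_data) (X X' X'' : Hom r s) (Y Y' Y'' : Hom s t)
      (f : X ⇒ X') (f' : X' ⇒ X'') (g : Y ⇒ Y') (g' : Y' ⇒ Y''),
    (f' ∘ f) ⋆ (g' ∘ g) = (f' ⋆ g') ∘ (f ⋆ g);
  tensA : forall (r s t u : tc_data) (X : Hom r s) (Y : Hom s t) (Z : Hom t u),
    (X ⊗ Y) ⊗ Z = X ⊗ (Y ⊗ Z);
  tensL : forall (r s : tc_data) (X : Hom r s), id1 r ⊗ X = X;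
  tensR : forall (r s : tc_data) (X : Hom r s), X ⊗ id1 s = X;
  hcompA : forall (r s t u : tc_data) (X X' : Hom r s) (Y Y' : Hom s t) (Z Z' : Hom t u)
      (f : X ⇒ X') (g : Y ⇒ Y') (h : Z ⇒ Z'),
    cast (tensA X' Y' Z') ∘ ((f ⋆ g) ⋆ h) = (f ⋆ (g ⋆ h)) ∘ cast (tensA X Y Z);
  hcompL : forall (r s : tc_data) (X X' : Hom r s) (f : X ⇒ X'),
    cast (tensL X') ∘ (id2 (id1 r) ⋆ f) = f ∘ cast (tensL X);
  hcompR : forall (r s : tc_data) (X X' : Hom r s) (f : X ⇒ X'),
    cast (tensR X') ∘ (f ⋆ id2 (id1 s)) = f ∘ cast (tensR X)
}.

Section Casts.
Context (C : TwoCat) (r s t u : C).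
Implicit Types (X : Hom r s) (Y : Hom s t) (Z : Hom t u).

Definition asc X Y Z : (X ⊗ Y) ⊗ Z ⇒ X ⊗ (Y ⊗ Z) := cast (tensA X Y Z).
Definition asc' X Y Z : X ⊗ (Y ⊗ Z) ⇒ (X ⊗ Y) ⊗ Z := cast (eq_sym (tensA X Y Z)).
Definition lu X : id1 r ⊗ X ⇒ X := cast (tensL X).
Definition lu' X : X ⇒ id1 r ⊗ X := cast (eq_sym (tensL X)).
Definition ru X : X ⊗ id1 s ⇒ X := cast (tensR X).
Definition ru' X : X ⇒ X ⊗ id1 s := cast (eq_sym (tensR X)).
End Casts.

Record Iso2 (C : TwoCat) (r s : C) (X Y : Hom r s) := {
  fwd :> X ⇒ Y;
  bwd : Y ⇒ X;
  fwdK : bwd ∘ fwd = id2 X;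
  bwdK : fwd ∘ bwd = id2 Y
}.

Definition is_iso (C : TwoCat) (r s : C) (X Y : Hom r s) (f : X ⇒ Y) : Prop :=
  exists g : Y ⇒ X, g ∘ f = id2 X /\ f ∘ g = id2 Y.

Record Pseudofunctor (C D : TwoCat) := {
  pf_ob :> C -> D;
  pf_hom : forall r s : C, Hom r s -> Hom (pf_ob r) (pf_ob s);
  pf_cell : forall (r s : C) (X Y : Hom r s), X ⇒ Y -> pf_hom X ⇒ pf_hom Y;
  pf_mult : forall (r s t : C) (X : Hom r s) (Y : Hom s t),
    Iso2 (pf_hom X ⊗ pf_hom Y) (pf_hom (X ⊗ Y));
  pf_unit : forall r : C, Iso2 (id1 (pf_ob r)) (pf_hom (id1 r));
  pf_id : forall (r s : C) (X : Hom r s), pf_cell (id2 X) = id2 (pf_hom X);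
  pf_comp : forall (r s : C) (X Y Z : Hom r s) (g : Y ⇒ Z) (f : X ⇒ Y),
    pf_cell (g ∘ f) = pf_cell g ∘ pf_cell f;
  pf_mult_nat : forall (r s t : C) (X X' : Hom r s) (Y Y' : Hom s t)
      (f : X ⇒ X') (g : Y ⇒ Y'),
    pf_mult X' Y' ∘ (pf_cell f ⋆ pf_cell g) = pf_cell (f ⋆ g) ∘ pf_mult X Y;
  pf_assoc : forall (r s t u : C) (X : Hom r s) (Y : Hom s t) (Z : Hom t u),
    pf_cell (asc X Y Z) ∘ pf_mult (X ⊗ Y) Z ∘ (pf_mult X Y ⋆ id2 (pf_hom Z))
    = pf_mult X (Y ⊗ Z) ∘ (id2 (pf_hom X) ⋆ pf_mult Y Z)
        ∘ asc (pf_hom X) (pf_hom Y) (pf_hom Z);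
  pf_unitL : forall (r s : C) (X : Hom r s),
    pf_cell (lu X) ∘ pf_mult (id1 r) X ∘ (pf_unit r ⋆ id2 (pf_hom X)) = lu (pf_hom X);
  pf_unitR : forall (r s : C) (X : Hom r s),
    pf_cell (ru X) ∘ pf_mult X (id1 s) ∘ (id2 (pf_hom X) ⋆ pf_unit s) = ru (pf_hom X)
}.

Arguments pf_hom {C D} F {r s} X : rename.
Arguments pf_cell {C D} F {r s X Y} f : rename.
Arguments pf_mult {C D} F {r s t} X Y : rename.
Arguments pf_unit {C D} F r : rename.

Record PseudonatData (C D : TwoCat) (F G : Pseudofunctor C D) := {
  pn_ob : forall r : C, Hom (F r) (G r);
  pn_cell : forall (r s : C) (X : Hom r s),
    pf_hom F X ⊗ pn_ob s ⇒ pn_ob r ⊗ pf_hom G X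
}.

Arguments pn_ob {C D F G} α r : rename.
Arguments pn_cell {C D F G} α {r s} X : rename.

Record IsPseudonat (C D : TwoCat) (F G : Pseudofunctor C D) (α : PseudonatData F G) : Prop := {
  pn_iso : forall (r s : C) (X : Hom r s), is_iso (pn_cell α X);
  pn_nat : forall (r s : C) (X Y : Hom r s) (f : X ⇒ Y),
    (id2 (pn_ob α r) ⋆ pf_cell G f) ∘ pn_cell α X
    = pn_cell α Y ∘ (pf_cell F f ⋆ id2 (pn_ob α s));
  pn_mult : forall (r s t : C) (X : Hom r s) (Y : Hom s t),
    pn_cell α (X ⊗ Y) ∘ (pf_mult F X Y ⋆ id2 (pn_ob α t))
    = (id2 (pn_ob α r) ⋆ pf_mult G X Y)
        ∘ asc (pn_ob α r) (pf_hom G X) (pf_hom G Y)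
        ∘ (pn_cell α X ⋆ id2 (pf_hom G Y))
        ∘ asc' (pf_hom F X) (pn_ob α s) (pf_hom G Y)
        ∘ (id2 (pf_hom F X) ⋆ pn_cell α Y)
        ∘ asc (pf_hom F X) (pf_hom F Y) (pn_ob α t);
  pn_unit : forall r : C,
    pn_cell α (id1 r) ∘ (pf_unit F r ⋆ id2 (pn_ob α r))
    = (id2 (pn_ob α r) ⋆ pf_unit G r) ∘ ru' (pn_ob α r) ∘ lu (pn_ob α r)
}.

Record Pseudonat (C D : TwoCat) (F G : Pseudofunctor C D) := {
  pn_data :> PseudonatData F G;
  pn_laws : IsPseudonat pn_data
}.

Definition IsModification (C D : TwoCat) (F G : Pseudofunctor C D) (α β : PseudonatData F G)
    (f : forall r : C, pn_ob α r ⇒ pn_ob β r) : Prop :=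
  forall (r s : C) (X : Hom r s),
    pn_cell β X ∘ (id2 (pf_hom F X) ⋆ f s) = (f r ⋆ id2 (pf_hom G X)) ∘ pn_cell α X.

Record Modification (C D : TwoCat) (F G : Pseudofunctor C D) (α β : Pseudonat F G) := {
  md_cell :> forall r : C, pn_ob α r ⇒ pn_ob β r;
  md_laws : IsModification md_cell
}.

(* A calculus for proofs: 2-morphisms with varying source and target are
   packed into one type, on which horizontal composition is strictly associative
   and unital and casts are invisible; vertical composition becomes partial. *)
Section Packed.
Context {C : TwoCat}.

Record packed (r s : C) := Pack { pk_dom : Hom r s; pk_cod : Hom r s; pk_cell : pk_dom ⇒ pk_cod }.

Definition pk (r s : C) (X Y : Hom r s) (f : X ⇒ Y) : option (packed r s) := Some (Pack f).

Definition pkv (r s : C) (g f : option (packed r s)) : option (packed r s) :=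
  match g, f with
  | Some (Pack g), Some (Pack f) =>
      match excluded_middle_informative (_ = _) with
      | left e => pk (g ∘ cast e ∘ f)
      | right _ => None
      end
  | _, _ => None
  end.

Definition pkh (r s t : C) (f : option (packed r s)) (g : option (packed s t)) :
    option (packed r t) :=
  match f, g with Some (Pack f), Some (Pack g) => pk (f ⋆ g) | _, _ => None end.

Lemma cast_irr (r s : C) (X Y : Hom r s) (e e' : X = Y) : cast e = cast e'.
Proof. by rewrite (proof_irrelevance _ e e'). Qed.

Lemma cast_id (r s : C) (X : Hom r s) (e : X = X) : cast e = id2 X.
Proof. by rewrite (proof_irrelevance _ e eq_refl). Qed.

Lemma pk_inj (r s : C) (X Y : Hom r s) (f g : X ⇒ Y) : pk f = pk g -> f = g.
Proof.
have H : forall p q : packed r s, p = q ->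
    forall (e : pk_dom p = pk_dom q) (e' : pk_cod p = pk_cod q),
    cast e' ∘ pk_cell p = pk_cell q ∘ cast e.
  by move=> p q -> e e'; rewrite !cast_id vcompL vcompR.
move=> /(f_equal (fun o => if o is Some p then p else Pack f)) E.
by have := H _ _ E eq_refl eq_refl; rewrite /= vcompL vcompR.
Qed.

Lemma pk_v (r s : C) (X Y Z : Hom r s) (g : Y ⇒ Z) (f : X ⇒ Y) :
  pk (g ∘ f) = pkv (pk g) (pk f).
Proof.
rewrite /pkv /=; case: excluded_middle_informative => [e|//].
by rewrite cast_id vcompR.
Qed.

Lemma pk_h (r s t : C) (X X' : Hom r s) (Y Y' : Hom s t) (f : X ⇒ X') (g : Y ⇒ Y') :
  pk (f ⋆ g) = pkh (pk f) (pk g).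
Proof. by []. Qed.

Lemma pk_castL (r s : C) (X Y Z : Hom r s) (e : Y = Z) (f : X ⇒ Y) : pk (cast e ∘ f) = pk f.
Proof. by case: Z / e => /=; rewrite vcompL. Qed.

Lemma pk_castR (r s : C) (X Y Z : Hom r s) (f : Y ⇒ Z) (e : X = Y) : pk (f ∘ cast e) = pk f.
Proof. by case: Y / e f => /= f; rewrite vcompR. Qed.

Lemma pk_cast (r s : C) (X Y : Hom r s) (e : X = Y) : pk (cast e) = pk (id2 Y).
Proof. by case: Y / e. Qed.

Lemma pk_id (r s t : C) (X : Hom r s) (Y : Hom s t) :
  pk (id2 (X ⊗ Y)) = pkh (pk (id2 X)) (pk (id2 Y)).
Proof. by rewrite -pk_h hcomp_id. Qed.

Lemma pkhA (r s t u : C) f g h :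
  @pkh r t u (@pkh r s t f g) h = pkh f (pkh g h).
Proof.
case: f => [[X X' f]|//]; case: g => [[Y Y' g]|//]; case: h => [[Z Z' h]|] //.
rewrite /pkh /= -(pk_castL (tensA X' Y' Z')) hcompA; exact: pk_castR.
Qed.

Lemma pkhL (r s : C) f : @pkh r r s (pk (id2 (id1 r))) f = f.
Proof.
case: f => [[X X' f]|//].
by rewrite /pkh /= -(pk_castL (tensL X')) hcompL pk_castR.
Qed.

Lemma pkhR (r s : C) f : @pkh r s s f (pk (id2 (id1 s))) = f.
Proof.
case: f => [[X X' f]|//].
by rewrite /pkh /= -(pk_castL (tensR X')) hcompR pk_castR.
Qed.

Lemma pkvA (r s : C) f g h : @pkv r s (pkv f g) h = pkv f (pkv g h).
Proof.
case: f => [[X X' f]|//]; case: g => [[Y Y' g]|//]; case: h => [[Z Z' h]|];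
  last by rewrite /pkv; case: excluded_middle_informative.
rewrite /pkv; repeat (case: excluded_middle_informative => //= ?).
by rewrite !vcompA; congr (pk (_ ∘ _ ∘ _ ∘ _ ∘ _)); apply: cast_irr.
Qed.

Lemma pkvL (r s : C) (X Y : Hom r s) (f : X ⇒ Y) : pkv (pk (id2 Y)) (pk f) = pk f.
Proof. by rewrite -pk_v vcompL. Qed.

Lemma pkvR (r s : C) (X Y : Hom r s) (f : X ⇒ Y) : pkv (pk f) (pk (id2 X)) = pk f.
Proof. by rewrite -pk_v vcompR. Qed.

Lemma whiskerL (r s t : C) (Z : Hom r s) (X X' X'' : Hom s t) (g : X' ⇒ X'') (f : X ⇒ X') :
  id2 Z ⋆ (g ∘ f) = (id2 Z ⋆ g) ∘ (id2 Z ⋆ f).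
Proof. by rewrite -interchange vcompL. Qed.

Lemma whiskerR (r s t : C) (Z : Hom s t) (X X' X'' : Hom r s) (g : X' ⇒ X'') (f : X ⇒ X') :
  (g ∘ f) ⋆ id2 Z = (g ⋆ id2 Z) ∘ (f ⋆ id2 Z).
Proof. by rewrite -interchange vcompL. Qed.

Lemma cast_whiskerL (r s t : C) (Z : Hom r s) (X Y : Hom s t) (e : X = Y) :
  id2 Z ⋆ cast e = cast (f_equal (tens Z) e).
Proof. by case: Y / e; rewrite /= hcomp_id. Qed.

Lemma cast_whiskerR (r s t : C) (Z : Hom s t) (X Y : Hom r s) (e : X = Y) :
  cast e ⋆ id2 Z = cast (f_equal (fun X => X ⊗ Z) e).
Proof. by case: Y / e; rewrite /= hcomp_id. Qed.

Lemma cast_v (r s : C) (X Y Z : Hom r s) (e' : Y = Z) (e : X = Y) :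
  cast e' ∘ cast e = cast (eq_trans e e').
Proof. by case: Z / e'; rewrite /= vcompL. Qed.

Lemma cast_vR (r s : C) (X Y Z W : Hom r s) (f : Z ⇒ W) (e' : Y = Z) (e : X = Y) :
  f ∘ cast e' ∘ cast e = f ∘ cast (eq_trans e e').
Proof. by rewrite -vcompA cast_v. Qed.

Lemma pkv_front (r s : C) (a b w : option (packed r s)) :
  pkv a b = w -> forall z, pkv a (pkv b z) = pkv w z.
Proof. by move=> <- z; rewrite pkvA. Qed.

Lemma pkv_front3 (r s : C) (a b c w : option (packed r s)) :
  pkv a (pkv b c) = w -> forall z, pkv a (pkv b (pkv c z)) = pkv w z.
Proof. by move=> <- z; rewrite !pkvA. Qed.

Lemma is_iso_v (r s : C) (X Y Z : Hom r s) (g : Y ⇒ Z) (f : X ⇒ Y) :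
  is_iso g -> is_iso f -> is_iso (g ∘ f).
Proof.
move=> [g' [Hg Hg']] [f' [Hf Hf']]; exists (f' ∘ g'); split.
- by rewrite vcompA -(vcompA f' g') Hg vcompR.
- by rewrite vcompA -(vcompA g f) Hf' vcompR.
Qed.

Lemma is_iso_h (r s t : C) (X X' : Hom r s) (Y Y' : Hom s t) (f : X ⇒ X') (g : Y ⇒ Y') :
  is_iso f -> is_iso g -> is_iso (f ⋆ g).
Proof.
move=> [f' [Hf Hf']] [g' [Hg Hg']]; exists (f' ⋆ g').
by rewrite -!interchange Hf Hg Hf' Hg' !hcomp_id.
Qed.

Lemma is_iso_cast (r s : C) (X Y : Hom r s) (e : X = Y) : is_iso (cast e).
Proof. by case: Y / e; exists (id2 X); rewrite /= vcompL. Qed.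

Lemma slide (r s t : C) (X X' : Hom r s) (Y Y' : Hom s t) (f : X ⇒ X') (g : Y ⇒ Y') :
  (id2 X' ⋆ g) ∘ (f ⋆ id2 Y) = (f ⋆ id2 Y') ∘ (id2 X ⋆ g).
Proof. by rewrite -!interchange !vcompL !vcompR. Qed.

End Packed.

(* Normal form: vertical composites of horizontal composites, both
   associated to the right, without casts. *)
Ltac pk_norm :=
  rewrite /asc /asc' /lu /lu' /ru /ru';
  repeat (rewrite !(vcompL, vcompR, hcomp_id, whiskerL, whiskerR, cast_whiskerL, cast_whiskerR));
  rewrite ?vcompA ?(vcompL, vcompR) ?(cast_v, cast_vR);
  rewrite ?(pk_castL, pk_castR, pk_cast, pk_v);
  rewrite ?(pkvL, pkvR) ?(pk_h, pk_id);
  rewrite ?(pkhA, pkhL, pkhR, pkvA).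

Section Fun.
Context (C D : TwoCat).

Lemma modification_eq (F G : Pseudofunctor C D) (α β : Pseudonat F G) (f g : Modification α β) :
  (forall r, f r = g r) -> f = g.
Proof.
case: f g => [f Hf] [g Hg] /= E.
have {}E : f = g by apply: functional_extensionality_dep.
by subst g; rewrite (proof_irrelevance _ Hf Hg).
Qed.

Lemma pseudonat_eq (F G : Pseudofunctor C D) (α β : Pseudonat F G) :
  (forall r, pn_ob α r = pn_ob β r) ->
  (forall r s (X : Hom r s), pk (pn_cell α X) = pk (pn_cell β X)) -> α = β.
Proof.
case: α β => [[a α] Hα] [[b β] Hβ] /= E E2.
have {}E : a = b by apply: functional_extensionality_dep.
subst b; have {}E2 : α = β.
  apply: functional_extensionality_dep => r; apply: functional_extensionality_dep => s.
  apply: functional_extensionality_dep => X; apply: pk_inj; exact: E2.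
by subst β; rewrite (proof_irrelevance _ Hα Hβ).
Qed.

Section Id.
Context (F : Pseudofunctor C D).

Definition pn_id_data : PseudonatData F F :=
  {| pn_ob := fun r => id1 (F r);
     pn_cell := fun r s X => lu' (pf_hom F X) ∘ ru (pf_hom F X) |}.

Lemma pn_id_laws : IsPseudonat pn_id_data.
Proof.
split=> /=.
- by move=> r s X; exists (ru' (pf_hom F X) ∘ lu (pf_hom F X)); split; apply: pk_inj; pk_norm.
- by move=> r s X Y f; apply: pk_inj; pk_norm.
- by move=> r s t X Y; apply: pk_inj; pk_norm.
- by move=> r; apply: pk_inj; pk_norm.
Qed.

Definition pn_id : Pseudonat F F := {| pn_laws := pn_id_laws |}.
End Id.

Section Tens.
Context (F G H : Pseudofunctor C D).

Definition pn_tens_data (α : PseudonatData F G) (β : PseudonatData G H) : PseudonatData F H :=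
  {| pn_ob := fun r => pn_ob α r ⊗ pn_ob β r;
     pn_cell := fun r s X =>
       asc' (pn_ob α r) (pn_ob β r) (pf_hom H X)
         ∘ (id2 (pn_ob α r) ⋆ pn_cell β X)
         ∘ asc (pn_ob α r) (pf_hom G X) (pn_ob β s)
         ∘ (pn_cell α X ⋆ id2 (pn_ob β s))
         ∘ asc' (pf_hom F X) (pn_ob α s) (pn_ob β s) |}.

Lemma pn_tens_laws (α : Pseudonat F G) (β : Pseudonat G H) : IsPseudonat (pn_tens_data α β).
Proof.
split=> /=.
- move=> r s X; have := pn_iso (pn_laws α) X; have := pn_iso (pn_laws β) X => Hβ Hα.
  by repeat (apply: is_iso_v || apply: is_iso_h || apply: is_iso_cast || assumption ||
    apply: (is_iso_cast eq_refl)).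
- move=> r s X Y f.
  move: (f_equal (fun z => pk (z ⋆ id2 (pn_ob β s))) (pn_nat (pn_laws α) f))
    (f_equal (fun z => pk (id2 (pn_ob α r) ⋆ z)) (pn_nat (pn_laws β) f)).
  pk_norm => E1 E2.
  by apply: pk_inj; pk_norm; rewrite (pkv_front E2) pkvA E1.
- move=> r s t X Y.
  move: (f_equal (fun z => pk (z ⋆ id2 (pn_ob β t))) (pn_mult (pn_laws α) X Y))
    (f_equal (fun z => pk (id2 (pn_ob α r) ⋆ z)) (pn_mult (pn_laws β) X Y))
    (f_equal (fun z => pk z) (slide (pn_cell α X) (pn_cell β Y))).
  pk_norm => E1 E2 E3; apply: pk_inj; pk_norm; rewrite E1 (pkv_front E2) !pkvA.
  by rewrite (pkv_front E3) pkvA.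
- move=> r.
  move: (f_equal (fun z => pk (z ⋆ id2 (pn_ob β r))) (pn_unit (pn_laws α) r))
    (f_equal (fun z => pk (id2 (pn_ob α r) ⋆ z)) (pn_unit (pn_laws β) r)).
  by pk_norm => E1 E2; apply: pk_inj; pk_norm; rewrite E1.
Qed.

Definition pn_tens (α : Pseudonat F G) (β : Pseudonat G H) : Pseudonat F H :=
  {| pn_laws := pn_tens_laws α β |}.
End Tens.

Section Modifications.
Context (F G H : Pseudofunctor C D).

Lemma md_id_laws (α : Pseudonat F G) : IsModification (fun r => id2 (pn_ob α r)).
Proof. by move=> r s X /=; rewrite !hcomp_id vcompL vcompR. Qed.

Definition md_id (α : Pseudonat F G) : Modification α α := {| md_laws := md_id_laws α |}.

Lemma md_v_laws (α β γ : Pseudonat F G) (g : Modification β γ) (f : Modification α β) :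
  @IsModification C D F G α γ (fun r => g r ∘ f r).
Proof.
move=> r s X; rewrite whiskerL whiskerR vcompA (md_laws g) -vcompA (md_laws f).
by rewrite vcompA.
Qed.

Definition md_v (α β γ : Pseudonat F G) (g : Modification β γ) (f : Modification α β) :
  Modification α γ := {| md_laws := md_v_laws g f |}.

Lemma md_h_laws (α α' : Pseudonat F G) (β β' : Pseudonat G H)
    (f : Modification α α') (g : Modification β β') :
  IsModification (α := pn_tens α β) (β := pn_tens α' β') (fun r => f r ⋆ g r).
Proof.
move=> r s X /=.
have E r' : f r' ⋆ g r' = (id2 (pn_ob α' r') ⋆ g r') ∘ (f r' ⋆ id2 (pn_ob β r')).
  by rewrite -interchange vcompL vcompR.
rewrite !E; apply: pk_inj.
move: (f_equal (fun z => pk (z ⋆ id2 (pn_ob β s))) (md_laws f X))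
  (f_equal (fun z => pk (id2 (pn_ob α' r) ⋆ z)) (md_laws g X))
  (f_equal (fun z => pk z) (slide (pn_cell α' X) (g s)))
  (f_equal (fun z => pk z) (slide (f r) (pn_cell β X))).
pk_norm => E1 E2 E3 E4.
by rewrite (pkv_front (eq_sym E3)) pkvA E1 (pkv_front E2) pkvA (pkv_front E4) pkvA.
Qed.

Definition md_h (α α' : Pseudonat F G) (β β' : Pseudonat G H)
    (f : Modification α α') (g : Modification β β') :
  Modification (pn_tens α β) (pn_tens α' β') := {| md_laws := md_h_laws f g |}.

End Modifications.

Definition FunData : TwoCatData := {|
  Ob := Pseudofunctor C D;
  Hom := @Pseudonat C D;
  Cell := @Modification C D;
  id1 := @pn_id;
  tens := @pn_tens;
  id2 := @md_id;
  vcomp := @md_v;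
  hcomp := @md_h
|}.

Lemma md_cast (F G : FunData) (α β : Hom F G) (e : α = β) (r : C) :
  md_cell (cast e) r = cast (f_equal (fun γ : Pseudonat F G => pn_ob γ r) e).
Proof. by case: β / e. Qed.

Lemma pn_tensA (E F G H : Pseudofunctor C D)
    (α : Pseudonat E F) (β : Pseudonat F G) (γ : Pseudonat G H) :
  pn_tens (pn_tens α β) γ = pn_tens α (pn_tens β γ).
Proof. by apply: pseudonat_eq => [r|r s X] /=; [apply: tensA | pk_norm]. Qed.

Lemma pn_tensL (F G : Pseudofunctor C D) (α : Pseudonat F G) : pn_tens (pn_id F) α = α.
Proof. by apply: pseudonat_eq => [r|r s X] /=; [apply: tensL | pk_norm]. Qed.

Lemma pn_tensR (F G : Pseudofunctor C D) (α : Pseudonat F G) : pn_tens α (pn_id G) = α.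
Proof. by apply: pseudonat_eq => [r|r s X] /=; [apply: tensR | pk_norm]. Qed.

Definition Fun : TwoCat.
Proof.
refine {| tc_data := FunData; tensA := pn_tensA; tensL := pn_tensL; tensR := pn_tensR |}.
- abstract (by move=> *; apply: modification_eq => r; apply: vcompA).
- abstract (by move=> *; apply: modification_eq => r; apply: vcompL).
- abstract (by move=> *; apply: modification_eq => r; apply: vcompR).
- abstract (by move=> *; apply: modification_eq => r; apply: hcomp_id).
- abstract (by move=> *; apply: modification_eq => r; apply: interchange).
- abstract (move=> *; apply: modification_eq => r /=; rewrite !md_cast;
    by move: (f_equal _ _) (f_equal _ _) => /= e e'; apply: pk_inj; pk_norm).
- abstract (move=> *; apply: modification_eq => r /=; rewrite !md_cast;
    by move: (f_equal _ _) (f_equal _ _) => /= e e'; apply: pk_inj; pk_norm).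
- abstract (move=> *; apply: modification_eq => r /=; rewrite !md_cast;
    by move: (f_equal _ _) (f_equal _ _) => /= e e'; apply: pk_inj; pk_norm).
Defined.

End Fun.

(* [Duality X A]: the 1-morphism A is a right dual of X, and X is a left dual
   of A. *)
Record Duality (C : TwoCat) (r s : C) (X : Hom r s) (A : Hom s r) := {
  cup : id1 s ⇒ A ⊗ X;
  cap : X ⊗ A ⇒ id1 r;
  snakeL : lu X ∘ (cap ⋆ id2 X) ∘ asc' X A X ∘ (id2 X ⋆ cup) ∘ ru' X = id2 X;
  snakeR : ru A ∘ (id2 A ⋆ cap) ∘ asc A X A ∘ (cup ⋆ id2 A) ∘ lu' A = id2 A
}.

Section Duality.
Context {C : TwoCat}.

Definition rtranspose (r s : C) (X Y : Hom r s) (A B : Hom s r)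
    (dX : Duality X A) (dY : Duality Y B) (f : X ⇒ Y) : B ⇒ A :=
  ru A ∘ (id2 A ⋆ cap dY) ∘ asc A Y B ∘ ((id2 A ⋆ f) ⋆ id2 B) ∘ (cup dX ⋆ id2 B) ∘ lu' B.

Definition mate (r s : C) (X Y : Hom r s) (A B : Hom s r)
    (dX : Duality X A) (dY : Duality Y B) (f : X ⇒ Y) (g : B ⇒ A) : Prop :=
  (id2 A ⋆ f) ∘ cup dX = (g ⋆ id2 Y) ∘ cup dY.

Lemma rtranspose_mate (r s : C) (X Y : Hom r s) (A B : Hom s r)
    (dX : Duality X A) (dY : Duality Y B) (f : X ⇒ Y) : mate dX dY f (rtranspose dX dY f).
Proof.
apply: pk_inj; rewrite /rtranspose.
move: (f_equal (fun z => pk z) (slide (cup dX) (cup dY)))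
  (f_equal (fun z => pk (id2 A ⋆ z)) (slide f (cup dY)))
  (f_equal (fun z => pk (id2 A ⋆ (z ∘ f))) (snakeL dY)).
pk_norm => E1 E2 E3.
by rewrite -E1 (pkv_front (eq_sym E2)) pkvA (pkv_front3 E3).
Qed.

Lemma mate_rtranspose (r s : C) (X Y : Hom r s) (A B : Hom s r)
    (dX : Duality X A) (dY : Duality Y B) (f : X ⇒ Y) (g : B ⇒ A) :
  mate dX dY f g -> g = rtranspose dX dY f.
Proof.
move=> M; apply: pk_inj; rewrite /rtranspose.
move: (f_equal (fun z => pk (z ⋆ id2 B)) M) (f_equal (fun z => pk z) (slide g (cap dY)))
  (f_equal (fun z => pk (g ∘ z)) (snakeR dY)).
by pk_norm => E1 E2 E3; rewrite E1 (pkv_front E2) pkvA.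
Qed.

Lemma mate_inj (r s : C) (X Y : Hom r s) (A B : Hom s r)
    (dX : Duality X A) (dY : Duality Y B) (f : X ⇒ Y) (g g' : B ⇒ A) :
  mate dX dY f g -> mate dX dY f g' -> g = g'.
Proof. by move=> /mate_rtranspose -> /mate_rtranspose. Qed.

Lemma mate_id (r s : C) (X : Hom r s) (A : Hom s r) (d : Duality X A) :
  mate d d (id2 X) (id2 A).
Proof. by []. Qed.

Lemma mate_v (r s : C) (X Y Z : Hom r s) (A B E : Hom s r)
    (dX : Duality X A) (dY : Duality Y B) (dZ : Duality Z E)
    (f : X ⇒ Y) (g : B ⇒ A) (f' : Y ⇒ Z) (g' : E ⇒ B) :
  mate dX dY f g -> mate dY dZ f' g' -> mate dX dZ (f' ∘ f) (g ∘ g').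
Proof.
rewrite /mate => M M'.
by rewrite whiskerL whiskerR -vcompA M -vcompA -M' !vcompA slide.
Qed.

Definition rtranspose_iso (r s : C) (X Y : Hom r s) (A B : Hom s r)
    (dX : Duality X A) (dY : Duality Y B) (f : Iso2 X Y) : Iso2 B A.
Proof.
refine {| fwd := rtranspose dX dY f; bwd := rtranspose dY dX (bwd f) |}.
- abstract (apply: (@mate_inj _ _ _ _ _ _ dY dY (id2 Y)); [|exact: mate_id];
    rewrite -(bwdK f); apply: mate_v; exact: rtranspose_mate).
- abstract (apply: (@mate_inj _ _ _ _ _ _ dX dX (id2 X)); [|exact: mate_id];
    rewrite -(fwdK f); apply: mate_v; exact: rtranspose_mate).
Defined.

Definition iso_id (r s : C) (X : Hom r s) : Iso2 X X :=
  {| fwd := id2 X; bwd := id2 X; fwdK := vcompL (id2 X); bwdK := vcompL (id2 X) |}.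

(* The canonical 2-isomorphism between two right duals of X. *)
Definition rcompare (r s : C) (X : Hom r s) (A B : Hom s r)
    (dA : Duality X A) (dB : Duality X B) : Iso2 A B :=
  rtranspose_iso dB dA (iso_id X).

Lemma rcompareP (r s : C) (X : Hom r s) (A B : Hom s r)
    (dA : Duality X A) (dB : Duality X B) (φ : A ⇒ B) :
  φ = rcompare dA dB <-> (φ ⋆ id2 X) ∘ cup dA = cup dB /\ cap dB ∘ (id2 X ⋆ φ) = cap dA.
Proof.
split=> [->|[E _]]; last first.
  by apply: mate_rtranspose; rewrite /mate E hcomp_id vcompL.
split.
  by have := rtranspose_mate dB dA (id2 X); rewrite /mate hcomp_id vcompL.
apply: pk_inj; rewrite /= /rtranspose.
move: (f_equal (fun z => pk z) (slide (cap dB) (cap dA)))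
  (f_equal (fun z => pk (cap dA ∘ (z ⋆ id2 A))) (snakeL dB)).
by pk_norm => E1 E2; rewrite (pkv_front (eq_sym E1)) pkvA E2.
Qed.

(* The canonical 2-isomorphism between two left duals of X. *)
Definition lcompare (r s : C) (X : Hom r s) (A B : Hom s r)
    (dA : Duality A X) (dB : Duality B X) : A ⇒ B :=
  lu B ∘ (cap dA ⋆ id2 B) ∘ asc' A X B ∘ (id2 A ⋆ cup dB) ∘ ru' A.

Lemma lcompareP (r s : C) (X : Hom r s) (A B : Hom s r)
    (dA : Duality A X) (dB : Duality B X) (φ : A ⇒ B) :
  φ = lcompare dA dB <-> (id2 X ⋆ φ) ∘ cup dA = cup dB /\ cap dB ∘ (φ ⋆ id2 X) = cap dA.
Proof.
rewrite /lcompare; split=> [->|[_ E]]; last first.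
  apply: pk_inj; move: (f_equal (fun z => pk (z ⋆ id2 B)) E)
    (f_equal (fun z => pk z) (slide φ (cup dB)))
    (f_equal (fun z => pk (z ∘ φ)) (snakeL dB)).
  by pk_norm => E1 E2 E3; rewrite -E1 pkvA -E2 E3.
split; apply: pk_inj.
- move: (f_equal (fun z => pk z) (slide (cup dA) (cup dB)))
    (f_equal (fun z => pk ((z ⋆ id2 B) ∘ cup dB)) (snakeR dA)).
  by pk_norm => E1 E2; rewrite E1.
- move: (f_equal (fun z => pk z) (slide (cap dA) (cap dB)))
    (f_equal (fun z => pk (cap dA ∘ (id2 A ⋆ z))) (snakeR dB)).
  by pk_norm => E1 E2; rewrite (pkv_front E1) pkvA.
Qed.

Definition tens_duality (r s t : C) (X : Hom r s) (A : Hom s r) (Y : Hom s t) (B : Hom t s)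
    (dX : Duality X A) (dY : Duality Y B) : Duality (X ⊗ Y) (B ⊗ A).
Proof.
refine {|
  cup := asc' B A (X ⊗ Y) ∘ (id2 B ⋆ asc A X Y) ∘ (id2 B ⋆ (cup dX ⋆ id2 Y))
           ∘ (id2 B ⋆ lu' Y) ∘ cup dY;
  cap := cap dX ∘ (id2 X ⋆ lu A) ∘ (id2 X ⋆ (cap dY ⋆ id2 A)) ∘ (id2 X ⋆ asc' Y B A)
           ∘ asc X Y (B ⊗ A) |}.
all: apply: pk_inj.
- move: (f_equal (fun z => pk (z ⋆ id2 Y)) (snakeL dX))
    (f_equal (fun z => pk (id2 X ⋆ z)) (snakeL dY))
    (f_equal (fun z => pk (id2 X ⋆ z ⋆ id2 Y)) (slide (cap dY) (cup dX))).
  pk_norm => E1 E2 E3.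
  abstract (by rewrite (pkv_front (eq_sym E3)) pkvA (pkv_front E1) E2 -pk_id pkvL).
- move: (f_equal (fun z => pk (id2 B ⋆ z)) (snakeR dX))
    (f_equal (fun z => pk (z ⋆ id2 A)) (snakeR dY))
    (f_equal (fun z => pk (id2 B ⋆ z ⋆ id2 A)) (slide (cup dX) (cap dY))).
  pk_norm => E1 E2 E3.
  abstract (by rewrite (pkv_front E3) pkvA (pkv_front E1) E2 -pk_id pkvL).
Defined.

Definition id_duality (r : C) : Duality (id1 r) (id1 r).
Proof.
refine {| cup := lu' (id1 r); cap := lu (id1 r) |}.
all: abstract (by apply: pk_inj; pk_norm).
Defined.

Definition shift_duality (r s : C) (X : Hom r s) (A B : Hom s r)
    (d : Duality X A) (φ : Iso2 A B) : Duality X B.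
Proof.
refine {| cup := (φ ⋆ id2 X) ∘ cup d; cap := cap d ∘ (id2 X ⋆ bwd φ) |}.
all: apply: pk_inj.
- move: (f_equal (fun z => pk (id2 X ⋆ ((z ⋆ id2 X) ∘ cup d))) (fwdK φ))
    (f_equal (fun z => pk z) (snakeL d)).
  abstract (by pk_norm => E1 E2; rewrite E1 E2).
- move: (f_equal (fun z => pk z) (slide φ (cap d)))
    (f_equal (fun z => pk z) (slide φ (id2 X ⋆ bwd φ)))
    (f_equal (fun z => pk z) (slide (cup d) (bwd φ)))
    (f_equal (fun z => pk (φ ∘ z ∘ bwd φ)) (snakeR d))
    (f_equal (fun z => pk z) (bwdK φ)).
  pk_norm => E1 E2 E3 E4 E5.
  abstract (by rewrite (pkv_front E2) pkvA (pkv_front E1) pkvA E3 E4).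
Defined.

Lemma mate_h (r s t : C) (X X' : Hom r s) (A A' : Hom s r) (Y Y' : Hom s t) (B B' : Hom t s)
    (dX : Duality X A) (dX' : Duality X' A') (dY : Duality Y B) (dY' : Duality Y' B')
    (f : X ⇒ X') (f' : A' ⇒ A) (g : Y ⇒ Y') (g' : B' ⇒ B) :
  mate dX dX' f f' -> mate dY dY' g g' ->
  mate (tens_duality dX dY) (tens_duality dX' dY') (f ⋆ g) (g' ⋆ f').
Proof.
rewrite /mate => M1 M2; apply: pk_inj.
have -> : f ⋆ g = (f ⋆ id2 Y') ∘ (id2 X ⋆ g) by rewrite -interchange vcompL vcompR.
have -> : g' ⋆ f' = (id2 B ⋆ f') ∘ (g' ⋆ id2 A') by rewrite -interchange vcompL vcompR.
move: (f_equal (fun z => pk (id2 B ⋆ z ⋆ id2 Y')) M1) (f_equal (fun z => pk z) M2)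
  (f_equal (fun z => pk (id2 B ⋆ z)) (slide (cup dX) g))
  (f_equal (fun z => pk (z ⋆ id2 Y')) (slide g' (cup dX'))) => /=.
pk_norm => E1 E2 E3 E4.
by rewrite (pkv_front E3) pkvA E2 (pkv_front E1) pkvA (pkv_front (eq_sym E4)) pkvA.
Qed.

Lemma mate_asc (r s t u : C) (X : Hom r s) (X' : Hom s r) (Y : Hom s t) (Y' : Hom t s)
    (Z : Hom t u) (Z' : Hom u t)
    (dX : Duality X X') (dY : Duality Y Y') (dZ : Duality Z Z') :
  mate (tens_duality (tens_duality dX dY) dZ) (tens_duality dX (tens_duality dY dZ))
    (asc X Y Z) (asc Z' Y' X').
Proof. by rewrite /mate /=; apply: pk_inj; pk_norm. Qed.

Lemma mate_lu (r s : C) (X : Hom r s) (A : Hom s r) (d : Duality X A) :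
  mate (tens_duality (id_duality r) d) d (lu X) (ru' A).
Proof. by rewrite /mate /=; apply: pk_inj; pk_norm. Qed.

Lemma mate_ru' (r s : C) (X : Hom r s) (A : Hom s r) (d : Duality X A) :
  mate d (tens_duality d (id_duality s)) (ru' X) (lu A).
Proof. by rewrite /mate /=; apply: pk_inj; pk_norm. Qed.

Lemma mate_ru (r s : C) (X : Hom r s) (A : Hom s r) (d : Duality X A) :
  mate (tens_duality d (id_duality s)) d (ru X) (lu' A).
Proof. by rewrite /mate /=; apply: pk_inj; pk_norm. Qed.

Lemma mate_lu' (r s : C) (X : Hom r s) (A : Hom s r) (d : Duality X A) :
  mate d (tens_duality (id_duality r) d) (lu' X) (ru A).
Proof. by rewrite /mate /=; apply: pk_inj; pk_norm. Qed.

Lemma rcompare_mate (r s : C) (X : Hom r s) (A B : Hom s r)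
    (dA : Duality X A) (dB : Duality X B) : mate dB dA (id2 X) (rcompare dA dB).
Proof. exact: rtranspose_mate. Qed.

Lemma mate_eq (r s : C) (X Y : Hom r s) (A B : Hom s r)
    (dX : Duality X A) (dY : Duality Y B) (f f' : X ⇒ Y) (g g' : B ⇒ A) :
  f = f' -> mate dX dY f g -> mate dX dY f' g' -> g = g'.
Proof. by move=> ->; apply: mate_inj. Qed.

End Duality.

Record RightDuals (C : TwoCat) := {
  rd_ob : forall r s : C, Hom r s -> Hom s r;
  rd_duality : forall (r s : C) (X : Hom r s), Duality X (rd_ob X)
}.

Arguments rd_ob {C} R {r s} X : rename.
Arguments rd_duality {C} R {r s} X : rename.

Section DoubleDual.
Context (C : TwoCat) (R : RightDuals C).
Local Notation "X ^*" := (rd_ob R X) (at level 2, format "X ^*").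
Local Notation d := (rd_duality R).

Definition rd_cell (r s : C) (X Y : Hom r s) (f : X ⇒ Y) : Y^* ⇒ X^* :=
  rtranspose (d X) (d Y) f.

(* (X ⊗ Y)^* and Y^* ⊗ X^* are both right dual to X ⊗ Y, and id^* and id are
   both right dual to id. *)
Definition rd_mult (r s t : C) (X : Hom r s) (Y : Hom s t) : Iso2 (X ⊗ Y)^* (Y^* ⊗ X^*) :=
  rcompare (d (X ⊗ Y)) (tens_duality (d X) (d Y)).

Definition rd_unit (r : C) : Iso2 (id1 r)^* (id1 r) := rcompare (d (id1 r)) (id_duality r).

Definition dd_mult (r s t : C) (X : Hom r s) (Y : Hom s t) :
    Iso2 (X^*^* ⊗ Y^*^*) (X ⊗ Y)^*^* :=
  rtranspose_iso (d (X ⊗ Y)^*) (tens_duality (d Y^*) (d X^*)) (rd_mult X Y).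

Definition dd_unit (r : C) : Iso2 (id1 r) (id1 r)^*^* :=
  rtranspose_iso (d (id1 r)^*) (id_duality r) (rd_unit r).

Let tr (r s : C) (X Y : Hom r s) (f : X ⇒ Y) : mate (d X) (d Y) f (rd_cell f).
Proof. exact: rtranspose_mate. Qed.

Let tr_mult (r s t : C) (X : Hom r s) (Y : Hom s t) :
  mate (tens_duality (d X) (d Y)) (d (X ⊗ Y)) (id2 (X ⊗ Y)) (rd_mult X Y).
Proof. exact: rcompare_mate. Qed.

Let tr_unit (r : C) : mate (id_duality r) (d (id1 r)) (id2 (id1 r)) (rd_unit r).
Proof. exact: rcompare_mate. Qed.

Let tr_dd_mult (r s t : C) (X : Hom r s) (Y : Hom s t) :
  mate (d (X ⊗ Y)^*) (tens_duality (d Y^*) (d X^*)) (rd_mult X Y) (dd_mult X Y).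
Proof. exact: rtranspose_mate. Qed.

Let tr_dd_unit (r : C) : mate (d (id1 r)^*) (id_duality r) (rd_unit r) (dd_unit r).
Proof. exact: rtranspose_mate. Qed.

Lemma rd_cell_id (r s : C) (X : Hom r s) : rd_cell (id2 X) = id2 X^*.
Proof. apply: mate_inj; [exact: tr | exact: mate_id]. Qed.

Lemma rd_cell_v (r s : C) (X Y Z : Hom r s) (g : Y ⇒ Z) (f : X ⇒ Y) :
  rd_cell (g ∘ f) = rd_cell f ∘ rd_cell g.
Proof. apply: mate_inj; [exact: tr | apply: mate_v; exact: tr]. Qed.

Lemma rd_mult_nat (r s t : C) (X X' : Hom r s) (Y Y' : Hom s t) (f : X ⇒ X') (g : Y ⇒ Y') :
  (rd_cell g ⋆ rd_cell f) ∘ rd_mult X' Y' = rd_mult X Y ∘ rd_cell (f ⋆ g).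
Proof.
apply: mate_eq; last first.
- by apply: mate_v; [exact: tr_mult | exact: tr].
- by apply: mate_v; [apply: mate_h; exact: tr | exact: tr_mult].
- by rewrite vcompL vcompR.
Qed.

Lemma rd_assoc (r s t u : C) (X : Hom r s) (Y : Hom s t) (Z : Hom t u) :
  (id2 Z^* ⋆ rd_mult X Y) ∘ (rd_mult (X ⊗ Y) Z ∘ rd_cell (asc X Y Z))
  = asc Z^* Y^* X^* ∘ ((rd_mult Y Z ⋆ id2 X^*) ∘ rd_mult X (Y ⊗ Z)).
Proof.
apply: mate_eq; last first.
- apply: mate_v; first exact: (mate_asc (d X) (d Y) (d Z)).
  by apply: mate_v; [apply: mate_h; [exact: mate_id | exact: tr_mult] | exact: tr_mult].
- apply: mate_v; first by apply: mate_h; [exact: tr_mult | exact: mate_id].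
  by apply: mate_v; [exact: tr_mult | exact: tr].
- by rewrite /= ?hcomp_id ?vcompL ?vcompR.
Qed.

Lemma rd_unitL (r s : C) (X : Hom r s) :
  (id2 X^* ⋆ rd_unit r) ∘ (rd_mult (id1 r) X ∘ rd_cell (lu X)) = ru' X^*.
Proof.
apply: mate_eq; last first.
- exact: mate_lu.
- apply: mate_v; first by apply: mate_h; [exact: tr_unit | exact: mate_id].
  by apply: mate_v; [exact: tr_mult | exact: tr].
- by rewrite !hcomp_id !vcompR.
Qed.

Lemma rd_unitR (r s : C) (X : Hom r s) :
  (rd_unit s ⋆ id2 X^*) ∘ (rd_mult X (id1 s) ∘ rd_cell (ru X)) = lu' X^*.
Proof.
apply: mate_eq; last first.
- exact: mate_ru.
- apply: mate_v; first by apply: mate_h; [exact: mate_id | exact: tr_unit].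
  by apply: mate_v; [exact: tr_mult | exact: tr].
- by rewrite !hcomp_id !vcompR.
Qed.

Lemma dd_mult_nat (r s t : C) (X X' : Hom r s) (Y Y' : Hom s t) (f : X ⇒ X') (g : Y ⇒ Y') :
  dd_mult X' Y' ∘ (rd_cell (rd_cell f) ⋆ rd_cell (rd_cell g))
  = rd_cell (rd_cell (f ⋆ g)) ∘ dd_mult X Y.
Proof.
apply: (mate_eq (rd_mult_nat f g)).
- by apply: mate_v; [exact: tr_dd_mult | apply: mate_h; exact: tr].
- by apply: mate_v; [exact: tr | exact: tr_dd_mult].
Qed.

Lemma dd_assoc (r s t u : C) (X : Hom r s) (Y : Hom s t) (Z : Hom t u) :
  rd_cell (rd_cell (asc X Y Z)) ∘ dd_mult (X ⊗ Y) Z ∘ (dd_mult X Y ⋆ id2 Z^*^*)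
  = dd_mult X (Y ⊗ Z) ∘ (id2 X^*^* ⋆ dd_mult Y Z) ∘ asc X^*^* Y^*^* Z^*^*.
Proof.
apply: (mate_eq (rd_assoc X Y Z)).
- apply: mate_v; last by apply: mate_h; [exact: mate_id | exact: tr_dd_mult].
  by apply: mate_v; [exact: tr | exact: tr_dd_mult].
- apply: mate_v; last exact: (mate_asc (d Z^*) (d Y^*) (d X^*)).
  apply: mate_v; first exact: tr_dd_mult.
  by apply: mate_h; [exact: tr_dd_mult | exact: mate_id].
Qed.

Lemma dd_unitL (r s : C) (X : Hom r s) :
  rd_cell (rd_cell (lu X)) ∘ dd_mult (id1 r) X ∘ (dd_unit r ⋆ id2 X^*^*) = lu X^*^*.
Proof.
apply: (mate_eq (rd_unitL X)).
- apply: mate_v; last by apply: mate_h; [exact: mate_id | exact: tr_dd_unit].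
  by apply: mate_v; [exact: tr | exact: tr_dd_mult].
- exact: mate_ru'.
Qed.

Lemma dd_unitR (r s : C) (X : Hom r s) :
  rd_cell (rd_cell (ru X)) ∘ dd_mult X (id1 s) ∘ (id2 X^*^* ⋆ dd_unit s) = ru X^*^*.
Proof.
apply: (mate_eq (rd_unitR X)).
- apply: mate_v; last by apply: mate_h; [exact: tr_dd_unit | exact: mate_id].
  by apply: mate_v; [exact: tr | exact: tr_dd_mult].
- exact: mate_lu'.
Qed.

Lemma dd_id (r s : C) (X : Hom r s) : rd_cell (rd_cell (id2 X)) = id2 X^*^*.
Proof. by rewrite !rd_cell_id. Qed.

Lemma dd_v (r s : C) (X Y Z : Hom r s) (g : Y ⇒ Z) (f : X ⇒ Y) :
  rd_cell (rd_cell (g ∘ f)) = rd_cell (rd_cell g) ∘ rd_cell (rd_cell f).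
Proof. by rewrite !rd_cell_v. Qed.

Definition double_dual : Pseudofunctor C C := {|
  pf_ob := fun r => r;
  pf_hom := fun r s X => X^*^*;
  pf_cell := fun r s X Y f => rd_cell (rd_cell f);
  pf_mult := dd_mult;
  pf_unit := dd_unit;
  pf_id := dd_id;
  pf_comp := dd_v;
  pf_mult_nat := dd_mult_nat;
  pf_assoc := dd_assoc;
  pf_unitL := dd_unitL;
  pf_unitR := dd_unitR
|}.
End DoubleDual.

Definition pf_idn (C : TwoCat) : Pseudofunctor C C.
Proof.
refine {|
  pf_ob := fun r => r;
  pf_hom := fun r s X => X;
  pf_cell := fun r s X Y f => f;
  pf_mult := fun r s t X Y => iso_id (X ⊗ Y);
  pf_unit := fun r => iso_id (id1 r)
|}.
all: abstract (by move=> * /=; apply: pk_inj; pk_norm).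
Defined.

Section Pivotal.
Context (C : TwoCat) (R : RightDuals C).
Local Notation "X ^*" := (rd_ob R X) (at level 2, format "X ^*").

(* An icon has identity 1-morphism components, so that its component at X is a
   2-morphism X^*^* ⊗ id ⇒ id ⊗ X, that is, X^*^* ⇒ X. *)
Definition icon_data (ι : forall (r s : C) (X : Hom r s), Iso2 X^*^* X) :
    PseudonatData (double_dual R) (pf_idn C) :=
  {| pn_ob := fun r => id1 r : Hom (double_dual R r) (pf_idn C r);
     pn_cell := fun r s X => lu' X ∘ ι r s X ∘ ru X^*^* |}.

Record PivotalStructure := {
  iota : forall (r s : C) (X : Hom r s), Iso2 X^*^* X;
  iota_icon : IsPseudonat (icon_data iota)
}.

(* The icon laws say that ι is natural and compatible with composition and
   identities. *)
Lemma icon_dataP (ι : forall (r s : C) (X : Hom r s), Iso2 X^*^* X) :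
  IsPseudonat (icon_data ι) <->
  (forall (r s : C) (X Y : Hom r s) (f : X ⇒ Y),
     f ∘ ι r s X = ι r s Y ∘ rd_cell R (rd_cell R f)) /\
  (forall (r s t : C) (X : Hom r s) (Y : Hom s t),
     ι r t (X ⊗ Y) ∘ dd_mult R X Y = ι r s X ⋆ ι s t Y) /\
  (forall r : C, ι r r (id1 r) ∘ dd_unit R r = id2 (id1 r)).
Proof.
split=> [[_ Hn Hm Hu]|[Hn [Hm Hu]]].
- split; last split.
  + move=> r s X Y f; move: (Hn r s X Y f); cbn -[rd_cell].
    move: (rd_cell R (rd_cell R f)) => g /(f_equal (fun z => pk z)).
    by pk_norm => E; apply: pk_inj; pk_norm.
  + move=> r s t X Y; move: (Hm r s t X Y); cbn -[dd_mult].
    move: (dd_mult R X Y) => [g _ _ _] /= /(f_equal (fun z => pk z)).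
    have -> : ι r s X ⋆ ι s t Y = (ι r s X ⋆ id2 Y) ∘ (id2 X^*^* ⋆ ι s t Y).
      by rewrite -interchange vcompL vcompR.
    by pk_norm => E; apply: pk_inj; pk_norm.
  + move=> r; move: (Hu r); cbn -[dd_unit].
    move: (dd_unit R r) => [g _ _ _] /= /(f_equal (fun z => pk z)).
    by pk_norm => E; apply: pk_inj; pk_norm.
- split; cbn -[rd_cell dd_mult dd_unit].
  + move=> r s X; apply: is_iso_v; last exact: is_iso_cast.
    apply: is_iso_v; first exact: is_iso_cast.
    by exists (bwd (ι r s X)); split; [apply: fwdK | apply: bwdK].
  + move=> r s X Y f; move: (f_equal (fun z => pk z) (Hn r s X Y f)).
    move: (rd_cell R (rd_cell R f)) => g.
    by pk_norm => E; apply: pk_inj; pk_norm.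
  + move=> r s t X Y; move: (f_equal (fun z => pk z) (Hm r s t X Y)).
    move: (dd_mult R X Y) => [g _ _ _] /=.
    have -> : ι r s X ⋆ ι s t Y = (ι r s X ⋆ id2 Y) ∘ (id2 X^*^* ⋆ ι s t Y).
      by rewrite -interchange vcompL vcompR.
    by pk_norm => E; apply: pk_inj; pk_norm.
  + move=> r; move: (f_equal (fun z => pk z) (Hu r)).
    move: (dd_unit R r) => [g _ _ _] /=.
    by pk_norm => E; apply: pk_inj; pk_norm.
Qed.

End Pivotal.

Arguments iota {C R} p {r s} X : rename.

Record PivotalTwoCat := {
  pc_cat :> TwoCat;
  pc_duals : RightDuals pc_cat;
  pc_pivotal : PivotalStructure pc_duals
}.

(* X^* as the chosen left dual of X, with cup (ι_X ⊗ id) ∘ η_{X^*} and cap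
   ε_{X^*} ∘ (id ⊗ ι_X⁻¹). *)
Definition ld_duality (C : PivotalTwoCat) (r s : C) (X : Hom r s) :
    Duality (rd_ob (pc_duals C) X) X :=
  shift_duality (rd_duality (pc_duals C) (rd_ob (pc_duals C) X)) (iota (pc_pivotal C) X).

Lemma pf_cast (C D : TwoCat) (F : Pseudofunctor C D) (r s : C) (X Y : Hom r s) (e : X = Y) :
  pf_cell F (cast e) = cast (f_equal (@pf_hom C D F r s) e).
Proof. by case: Y / e; rewrite /= pf_id. Qed.

Lemma iso_move (C : TwoCat) (r s : C) (X Y X' Y' : Hom r s) (i : Iso2 X X') (j : Iso2 Y Y')
    (a : X ⇒ Y) (b : X' ⇒ Y') : j ∘ a = b ∘ i -> a ∘ bwd i = bwd j ∘ b.
Proof. by move=> E; rewrite -(vcompR b) -(bwdK i) (vcompA b) -E !vcompA fwdK vcompL. Qed.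

Section Preservation.
Context (C D : TwoCat) (F : Pseudofunctor C D).

Lemma bwd_mult_nat (r s t : C) (X X' : Hom r s) (Y Y' : Hom s t) (f : X ⇒ X') (g : Y ⇒ Y') :
  (pf_cell F f ⋆ pf_cell F g) ∘ bwd (pf_mult F X Y)
  = bwd (pf_mult F X' Y') ∘ pf_cell F (f ⋆ g).
Proof. exact: iso_move (pf_mult_nat F f g). Qed.

Lemma bwd_unitL (r s : C) (X : Hom r s) :
  (bwd (pf_unit F r) ⋆ id2 (pf_hom F X)) ∘ bwd (pf_mult F (id1 r) X)
  = lu' (pf_hom F X) ∘ pf_cell F (lu X).
Proof.
have E : lu' (pf_hom F X) ∘ lu (pf_hom F X) = id2 (id1 (F r) ⊗ pf_hom F X).
  by rewrite /lu /lu' cast_v cast_id.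
rewrite -(pf_unitL F X) in E.
rewrite -(vcompL (_ ∘ bwd _)) -E -!vcompA; congr (_ ∘ _).
rewrite !vcompA -(vcompA _ (pf_unit F r ⋆ _)) -interchange bwdK vcompL hcomp_id vcompR.
by rewrite -vcompA bwdK vcompR.
Qed.

Lemma bwd_unitR (r s : C) (X : Hom r s) :
  (id2 (pf_hom F X) ⋆ bwd (pf_unit F s)) ∘ bwd (pf_mult F X (id1 s))
  = ru' (pf_hom F X) ∘ pf_cell F (ru X).
Proof.
have E : ru' (pf_hom F X) ∘ ru (pf_hom F X) = id2 (pf_hom F X ⊗ id1 (F s)).
  by rewrite /ru /ru' cast_v cast_id.
rewrite -(pf_unitR F X) in E.
rewrite -(vcompL (_ ∘ bwd _)) -E -!vcompA; congr (_ ∘ _).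
rewrite !vcompA -(vcompA _ (_ ⋆ _) (_ ⋆ _)) -interchange bwdK vcompL hcomp_id vcompR.
by rewrite -vcompA bwdK vcompR.
Qed.

Definition map_duality (r s : C) (X : Hom r s) (A : Hom s r) (d : Duality X A) :
  Duality (pf_hom F X) (pf_hom F A).
Proof.
refine {|
  cup := bwd (pf_mult F A X) ∘ pf_cell F (cup d) ∘ pf_unit F s;
  cap := bwd (pf_unit F r) ∘ pf_cell F (cap d) ∘ pf_mult F X A |}.
all: apply: pk_inj.
- move: (f_equal (fun z => pk (bwd (pf_mult F (X ⊗ A) X) ∘ pf_cell F (asc' X A X) ∘ z
                                ∘ asc' _ _ _)) (pf_assoc F X A X))
    (f_equal (fun z => pk (z ∘ (pf_mult F X A ⋆ id2 (pf_hom F X)))) (fwdK (pf_mult F (X ⊗ A) X)))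
    (f_equal (fun z => pk (id2 (pf_hom F X) ⋆ (z ∘ pf_cell F (cup d)))) (bwdK (pf_mult F A X)))
    (f_equal (fun z => pk z) (pf_mult_nat F (id2 X) (cup d)))
    (f_equal (fun z => pk (pf_cell F (id2 X ⋆ cup d) ∘ pf_cell F (ru' X) ∘ z)) (pf_unitR F X))
    (f_equal (fun z => pk z) (bwd_mult_nat (cap d) (id2 X)))
    (f_equal (fun z => pk (z ∘ pf_cell F (cap d ⋆ id2 X))) (bwd_unitL X))
    (f_equal (fun z => pk (pf_cell F z)) (snakeL d)).
  rewrite !pf_comp /asc /asc' /lu /lu' /ru /ru' !pf_cast !pf_id.
  abstract (pk_norm => E1 E2 E3 E4 E5 E6 E7 E8;
    by rewrite -E2 E1 !pkvA (pkv_front3 E3) (pkv_front E4) pkvA E5 (pkv_front E6) pkvA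
      (pkv_front3 E7) E8).
- move: (f_equal (fun z => pk (bwd (pf_mult F A (X ⊗ A)) ∘ z)) (pf_assoc F A X A))
    (f_equal (fun z => pk (z ∘ (id2 (pf_hom F A) ⋆ pf_mult F X A))) (fwdK (pf_mult F A (X ⊗ A))))
    (f_equal (fun z => pk ((z ∘ pf_cell F (cup d)) ⋆ id2 (pf_hom F A))) (bwdK (pf_mult F A X)))
    (f_equal (fun z => pk z) (pf_mult_nat F (cup d) (id2 A)))
    (f_equal (fun z => pk (pf_cell F (cup d ⋆ id2 A) ∘ pf_cell F (lu' A) ∘ z)) (pf_unitL F A))
    (f_equal (fun z => pk z) (bwd_mult_nat (id2 A) (cap d)))
    (f_equal (fun z => pk (z ∘ pf_cell F (id2 A ⋆ cap d))) (bwd_unitR A))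
    (f_equal (fun z => pk (pf_cell F z)) (snakeR d)).
  rewrite !pf_comp /asc /asc' /lu /lu' /ru /ru' !pf_cast !pf_id.
  abstract (pk_norm => E1 E2 E3 E4 E5 E6 E7 E8;
    by rewrite -E2 -E1 !pkvA (pkv_front3 E3) (pkv_front E4) pkvA E5 (pkv_front E6) pkvA
      (pkv_front3 E7) E8).
Defined.
End Preservation.

Section PivotalFunctors.
Context (C D : PivotalTwoCat).

(* F_r and F_l: F(X^* ) is compared with F(X)^* as a right, resp. left, dual
   of F(X). *)
Definition pf_right (F : Pseudofunctor C D) (r s : C) (X : Hom r s) :
    pf_hom F (rd_ob (pc_duals C) X) ⇒ rd_ob (pc_duals D) (pf_hom F X) :=
  rcompare (map_duality F (rd_duality (pc_duals C) X)) (rd_duality (pc_duals D) (pf_hom F X)).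

Definition pf_left (F : Pseudofunctor C D) (r s : C) (X : Hom r s) :
    pf_hom F (rd_ob (pc_duals C) X) ⇒ rd_ob (pc_duals D) (pf_hom F X) :=
  lcompare (map_duality F (ld_duality X)) (ld_duality (pf_hom F X)).

Definition pf_pivotal (F : Pseudofunctor C D) : Prop :=
  forall (r s : C) (X : Hom r s), pf_left F X = pf_right F X.
End PivotalFunctors.

Definition full_sub (C : TwoCat) (P : C -> Prop) : TwoCat.
Proof.
refine {|
  tc_data := {|
    Ob := {r : C | P r};
    Hom := fun r s => Hom (proj1_sig r) (proj1_sig s);
    Cell := fun r s X Y => X ⇒ Y;
    id1 := fun r => id1 (proj1_sig r);
    tens := fun r s t X Y => X ⊗ Y;
    id2 := fun r s X => id2 X;
    vcomp := fun r s X Y Z g f => g ∘ f;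
    hcomp := fun r s t X X' Y Y' f g => f ⋆ g |};
  vcompA := fun r s X Y Z W h g f => vcompA h g f;
  vcompL := fun r s X Y f => vcompL f;
  vcompR := fun r s X Y f => vcompR f;
  hcomp_id := fun r s t X Y => hcomp_id X Y;
  interchange := fun r s t X X' X'' Y Y' Y'' f f' g g' => interchange f f' g g';
  tensA := fun r s t u X Y Z => tensA X Y Z;
  tensL := fun r s X => tensL X;
  tensR := fun r s X => tensR X;
  hcompA := fun r s t u X X' Y Y' Z Z' f g h => hcompA f g h;
  hcompL := fun r s X X' f => hcompL f;
  hcompR := fun r s X X' f => hcompR f
|}.
Defined.

Definition Fun_p (C D : PivotalTwoCat) : TwoCat := full_sub (C := Fun C D) (@pf_pivotal C D).

Section FunDuals.
Context (C D : PivotalTwoCat).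

Section Data.
Context (F G : Pseudofunctor C D) (α : PseudonatData F G).

(* The component of α^* at X is the right transpose of the component of α at
   the left dual of X. *)
Definition pn_dual_data : PseudonatData G F :=
  {| pn_ob := fun r => rd_ob (pc_duals D) (pn_ob α r);
     pn_cell := fun r s X =>
       rtranspose
         (tens_duality (map_duality F (ld_duality X)) (rd_duality (pc_duals D) (pn_ob α r)))
         (tens_duality (rd_duality (pc_duals D) (pn_ob α s)) (map_duality G (ld_duality X)))
         (pn_cell α (rd_ob (pc_duals C) X)) |}.
End Data.

(* α^* is a pseudonatural transformation, and the cups and caps of the
   components of α form modifications.  The snake equations in Fun_p then hold
   componentwise. *)
Record FunDualLaws : Prop := {
  fd_pseudonat : forall F G : Pseudofunctor C D, pf_pivotal F -> pf_pivotal G ->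
    forall α : Pseudonat F G, IsPseudonat (pn_dual_data α);
  fd_cup : forall F G : Pseudofunctor C D, pf_pivotal F -> pf_pivotal G ->
    forall α : Pseudonat F G,
    IsModification (α := pn_id_data G) (β := pn_tens_data (pn_dual_data α) α)
      (fun r => cup (rd_duality (pc_duals D) (pn_ob α r)));
  fd_cap : forall F G : Pseudofunctor C D, pf_pivotal F -> pf_pivotal G ->
    forall α : Pseudonat F G,
    IsModification (α := pn_tens_data α (pn_dual_data α)) (β := pn_id_data F)
      (fun r => cap (rd_duality (pc_duals D) (pn_ob α r)))
}.

Context (L : FunDualLaws).

Definition fun_p_dual (F G : Fun_p C D) (α : Hom F G) : Hom G F :=
  {| pn_laws := fd_pseudonat L (proj2_sig F) (proj2_sig G) α |}.

Lemma md_cast_p (F G : Fun_p C D) (α β : Hom F G) (e : α = β) (r : C) :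
  md_cell (cast e) r = cast (f_equal (fun γ : Hom F G => pn_ob γ r) e).
Proof. by case: β / e. Qed.

Definition fun_p_cup (F G : Fun_p C D) (α : Hom F G) : id1 G ⇒ fun_p_dual α ⊗ α :=
  Build_Modification (α := pn_id (proj1_sig G)) (β := pn_tens (fun_p_dual α) α)
    (fd_cup L (proj2_sig F) (proj2_sig G) α).

Definition fun_p_cap (F G : Fun_p C D) (α : Hom F G) : α ⊗ fun_p_dual α ⇒ id1 F :=
  Build_Modification (α := pn_tens α (fun_p_dual α)) (β := pn_id (proj1_sig F))
    (fd_cap L (proj2_sig F) (proj2_sig G) α).

Definition fun_p_duality (F G : Fun_p C D) (α : Hom F G) : Duality α (fun_p_dual α).
Proof.
refine {| cup := fun_p_cup α; cap := fun_p_cap α |}.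
all: apply: modification_eq => r; rewrite /= !md_cast_p.
- rewrite -[RHS](snakeL (rd_duality (pc_duals D) (pn_ob α r))).
  abstract (congr (_ ∘ _ ∘ _ ∘ _ ∘ _); apply: cast_irr).
- rewrite -[RHS](snakeR (rd_duality (pc_duals D) (pn_ob α r))).
  abstract (congr (_ ∘ _ ∘ _ ∘ _ ∘ _); apply: cast_irr).
Defined.

Definition fun_p_duals : RightDuals (Fun_p C D) := {| rd_duality := fun_p_duality |}.
End FunDuals.

(* Main.v *)
From Stdlib Require Import ssreflect.
Require Import Defs.

(** The proof is a calculus of mates.  Given duals A of X and B of Y, the
    relation [mate dX dY f g] says that f : X ⇒ Y and g : B ⇒ A are transposes
    of each other.  Either one determines the other, and mates are closed under
    vertical and horizontal composition, so that an equation between 2-morphisms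
    follows from the equation between their mates.

    That α^* is pseudonatural is of this kind.  Its component at X is the mate of
    the component of α at ^*X, pseudofunctors carry mates to mates
    ([map_mate], [mate_mult], [mate_unit]), and hence the laws of α at left duals
    transpose to the laws of α^*.  It helps to define the component for an
    arbitrary left dual of X ([dual_cell]): by naturality of α it does not depend
    on the choice ([dual_cell_nat]), so at X ⊗ Y one may use ^*Y ⊗ ^*X and at an
    identity the identity.  The cups and caps of the components of α form
    modifications because α is natural with respect to the cup and the cap of
    ^*X ([pn_cup], [pn_cap]): after bending the strand G(X) or F(X), the
    modification law is that naturality.

    Pivotality enters in the claim that the ι_(α_r) form a modification
    α^** ⇒ α.  The component of α^** at X is a mate of a mate of α at X^**, taken
    with respect to duals F(X^* ) and F(X^** ) that are images under F and not
    the chosen duals of D.  The relation [pivot dX dA i] says that, when A is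
    any right dual of X and X' any right dual of A, the 2-morphism i : X ⇒ X' is the
    inverse of ι_X up to the canonical comparison of X' with X^**.  Any double mate
    is natural with respect to such i ([pivot_nat]).  They are compatible with ⊗
    because ι is monoidal ([pivot_tens]).  For the duals induced by a pivotal
    pseudofunctor F the identification is F(ι_X) : F(X^** ) ⇒ F(X)
    ([pf_pivot_ld]).  The last point uses F_l = F_r and also that ι_X identifies
    X^**, as the chosen left dual of X^*, with X ([ld_rd_mate]).  Naturality of
    double mates at α_(X^** ) and naturality of α at ι_X then combine to the
    modification law ([iota_modification]).

    The 2-category structure, the mates and hence the double dual functor of
    Fun_p are computed componentwise in D, so naturality and monoidality of the
    resulting icon are those of ι in D. *)

Set Implicit Arguments.
Unset Strict Implicit.
Local Open Scope tc_scope.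

(** * Mates *)

Section Mates.
Context {C : TwoCat}.

Definition ltranspose (r s : C) (X Y : Hom r s) (A B : Hom s r)
    (dX : Duality X A) (dY : Duality Y B) (g : B ⇒ A) : X ⇒ Y :=
  lu Y ∘ (cap dX ⋆ id2 Y) ∘ asc' X A Y ∘ (id2 X ⋆ (g ⋆ id2 Y)) ∘ (id2 X ⋆ cup dY) ∘ ru' X.

Lemma ltranspose_mate (r s : C) (X Y : Hom r s) (A B : Hom s r)
    (dX : Duality X A) (dY : Duality Y B) (g : B ⇒ A) : mate dX dY (ltranspose dX dY g) g.
Proof.
apply: pk_inj; rewrite /ltranspose.
move: (f_equal (fun z => pk z) (slide (cup dX) (cup dY)))
  (f_equal (fun z => pk (z ⋆ id2 Y)) (slide (cup dX) g))
  (f_equal (fun z => pk ((z ∘ g) ⋆ id2 Y)) (snakeR dX)).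
pk_norm => E1 E2 E3.
by rewrite E1 (pkv_front E2) pkvA (pkv_front3 E3).
Qed.

(** Since mates reverse composition, inverses of mates are mates. *)
Lemma mate_inv (r s : C) (X Y : Hom r s) (A B : Hom s r) (dX : Duality X A) (dY : Duality Y B)
    (f : Iso2 X Y) (g : Iso2 B A) : mate dX dY f g -> mate dY dX (bwd f) (bwd g).
Proof.
rewrite /mate => M.
have -> : cup dY = (bwd g ⋆ id2 Y) ∘ ((id2 A ⋆ f) ∘ cup dX).
  by rewrite M vcompA -whiskerR fwdK hcomp_id vcompL.
by rewrite (vcompA (bwd g ⋆ _)) -slide !vcompA -whiskerL fwdK hcomp_id vcompL.
Qed.

(** The relation of mates is defined by cups; the snake equations give the form
    with caps. *)
Lemma cap_mate (r s : C) (X Y : Hom r s) (A B : Hom s r) (dX : Duality X A) (dY : Duality Y B)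
    (f : X ⇒ Y) (g : B ⇒ A) : mate dX dY f g ->
  cap dY ∘ (f ⋆ id2 B) = cap dX ∘ (id2 X ⋆ g).
Proof.
move=> M; apply: pk_inj.
rewrite (mate_rtranspose M) /rtranspose.
move: (f_equal (fun z => pk z) (slide (cap dX) (cap dY)))
   (f_equal (fun z => pk (z ⋆ id2 B)) (slide (cap dX) f))
   (f_equal (fun z => pk ((f ∘ z) ⋆ id2 B)) (snakeL dX)).
pk_norm => E1 E2 E3.
by rewrite (pkv_front (eq_sym E1)) pkvA (pkv_front (eq_sym E2)) pkvA E3.
Qed.

Lemma mate_asc' (r s t u : C) (X : Hom r s) (X' : Hom s r) (Y : Hom s t) (Y' : Hom t s)
    (Z : Hom t u) (Z' : Hom u t)
    (dX : Duality X X') (dY : Duality Y Y') (dZ : Duality Z Z') :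
  mate (tens_duality dX (tens_duality dY dZ)) (tens_duality (tens_duality dX dY) dZ)
    (asc' X Y Z) (asc' Z' Y' X').
Proof. by rewrite /mate /=; apply: pk_inj; pk_norm. Qed.

Lemma mate_shift (r s : C) (X : Hom r s) (A B : Hom s r)
    (d : Duality X A) (φ : Iso2 A B) : mate d (shift_duality d φ) (id2 X) (bwd φ).
Proof. by rewrite /mate /= vcompA -whiskerR fwdK. Qed.

Lemma mate_unshift (r s : C) (X : Hom r s) (A B : Hom s r)
    (d : Duality X A) (φ : Iso2 A B) : mate (shift_duality d φ) d (id2 X) φ.
Proof. by rewrite /mate /= hcomp_id vcompL. Qed.

(** The transpose of a cup of d : A dual to X is the cap of d' : X' dual to A.  The
    mate relation reduces to a snake equation of d', and for [mate_cap] to one of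
    d. *)
Lemma mate_cup (r s : C) (X : Hom r s) (A : Hom s r) (X' : Hom r s)
    (d : Duality X A) (d' : Duality A X') :
  mate (id_duality s) (tens_duality d' d) (cup d) (cap d').
Proof.
rewrite /mate /=; apply: pk_inj.
move: (f_equal (fun z => pk (z ⋆ id2 X)) (snakeL d')).
by pk_norm => E; rewrite (pkv_front E) -pk_id pkvL.
Qed.

Lemma mate_cap (r s : C) (X : Hom r s) (A : Hom s r) (X' : Hom r s)
    (d : Duality X A) (d' : Duality A X') :
  mate (tens_duality d d') (id_duality r) (cap d) (cup d').
Proof.
rewrite /mate /=; apply: pk_inj.
move: (f_equal (fun z => pk (id2 X' ⋆ z)) (snakeR d)).
by pk_norm => E; rewrite (pkv_front E) -pk_id pkvL.
Qed.

(** Bending the outgoing strand A back with the cap recovers a. *)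
Lemma cup_inj (r s : C) (X Y : Hom r s) (A : Hom s r) (e : Duality A X) (a b : X ⇒ Y) :
  (a ⋆ id2 A) ∘ cup e = (b ⋆ id2 A) ∘ cup e -> a = b.
Proof.
have H c : pk c = pk (ru Y ∘ (id2 Y ⋆ cap e) ∘ asc Y A X ∘ (((c ⋆ id2 A) ∘ cup e) ⋆ id2 X) ∘ lu' X).
  move: (f_equal (fun z => pk z) (slide c (cap e))) (f_equal (fun z => pk (c ∘ z)) (snakeR e)).
  by pk_norm => E1 E2; rewrite (pkv_front E1) pkvA E2.
by move=> E; apply: pk_inj; rewrite H E -H.
Qed.

Lemma cap_inj (r s : C) (X Z : Hom r s) (A : Hom s r) (e : Duality A X) (a b : Z ⇒ X) :
  cap e ∘ (id2 A ⋆ a) = cap e ∘ (id2 A ⋆ b) -> a = b.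
Proof.
have H c : pk c = pk (ru X ∘ (id2 X ⋆ (cap e ∘ (id2 A ⋆ c))) ∘ asc X A Z ∘ (cup e ⋆ id2 Z) ∘ lu' Z).
  move: (f_equal (fun z => pk z) (slide (cup e) c)) (f_equal (fun z => pk (z ∘ c)) (snakeR e)).
  by pk_norm => E1 E2; rewrite E1 E2.
by move=> E; apply: pk_inj; rewrite H E -H.
Qed.
End Mates.

(** * Pseudofunctors preserve mates and composites of duals *)

Section Functor.
Context (C D : TwoCat) (F : Pseudofunctor C D).

Definition pf_iso (r s : C) (X Y : Hom r s) (i : Iso2 X Y) :
  Iso2 (pf_hom F X) (pf_hom F Y).
Proof.
refine {| fwd := pf_cell F i; bwd := pf_cell F (bwd i) |}.
- abstract (by rewrite -pf_comp fwdK pf_id).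
- abstract (by rewrite -pf_comp bwdK pf_id).
Defined.

Lemma map_mate (r s : C) (X Y : Hom r s) (A B : Hom s r) (dX : Duality X A) (dY : Duality Y B)
    (f : X ⇒ Y) (g : B ⇒ A) : mate dX dY f g ->
  mate (map_duality F dX) (map_duality F dY) (pf_cell F f) (pf_cell F g).
Proof.
rewrite /mate /= -!(pf_id F) !vcompA !bwd_mult_nat => M.
by rewrite -!(vcompA _ (pf_cell F _) (pf_cell F _)) -!pf_comp M.
Qed.

(** Associativity of the multiplicator, solved for the two inverses on opposite
    sides. *)
Lemma bwd_multA (r s t u : C) (X : Hom r s) (Y : Hom s t) (Z : Hom t u) :
  (id2 (pf_hom F X) ⋆ pf_mult F Y Z) ∘ asc _ _ _ ∘ (bwd (pf_mult F X Y) ⋆ id2 (pf_hom F Z))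
  = bwd (pf_mult F X (Y ⊗ Z)) ∘ pf_cell F (asc X Y Z) ∘ pf_mult F (X ⊗ Y) Z.
Proof.
apply: pk_inj.
move: (f_equal (fun z => pk (bwd (pf_mult F X (Y ⊗ Z)) ∘ z ∘ (bwd (pf_mult F X Y) ⋆ id2 _)))
    (pf_assoc F X Y Z))
  (f_equal (fun z => pk (z ∘ (id2 (pf_hom F X) ⋆ pf_mult F Y Z))) (fwdK (pf_mult F X (Y ⊗ Z))))
  (f_equal (fun z => pk (z ⋆ id2 (pf_hom F Z))) (bwdK (pf_mult F X Y))).
rewrite /asc !pf_cast; pk_norm => E1 E2 E3.
by rewrite -(pkv_front E2) pkvA -E1 E3 -pk_id pkvR.
Qed.

Lemma bwd_assoc (r s t u : C) (X : Hom r s) (Y : Hom s t) (Z : Hom t u) :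
  asc _ _ _ ∘ (bwd (pf_mult F X Y) ⋆ id2 (pf_hom F Z)) ∘ bwd (pf_mult F (X ⊗ Y) Z)
  = (id2 (pf_hom F X) ⋆ bwd (pf_mult F Y Z)) ∘ bwd (pf_mult F X (Y ⊗ Z)) ∘ pf_cell F (asc X Y Z).
Proof.
apply: pk_inj.
move: (f_equal (fun z => pk ((id2 (pf_hom F X) ⋆ bwd (pf_mult F Y Z)) ∘ z
    ∘ bwd (pf_mult F (X ⊗ Y) Z))) (bwd_multA X Y Z))
  (f_equal (fun z => pk ((id2 (pf_hom F X) ⋆ z) ∘ asc _ _ _ ∘
     (bwd (pf_mult F X Y) ⋆ id2 (pf_hom F Z)))) (fwdK (pf_mult F Y Z)))
  (f_equal (fun z => pk (pf_cell F (asc X Y Z) ∘ z)) (bwdK (pf_mult F (X ⊗ Y) Z))).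
rewrite /asc !pf_cast; pk_norm => E1 E2 E3.
by move: E1; rewrite E3 pkvR (pkv_front3 E2).
Qed.

Lemma mate_unit (r : C) :
  mate (id_duality (F r)) (map_duality F (id_duality r)) (pf_unit F r) (bwd (pf_unit F r)).
Proof.
rewrite /mate /=.
rewrite !vcompA bwd_unitL /lu' /lu.
by rewrite pf_cast (pf_cast F); apply: pk_inj; pk_norm.
Qed.

(** The image of a composite duality is the composite of the images, along the
    multiplicators. *)
Lemma mate_mult (r s t : C) (X : Hom r s) (A : Hom s r) (Y : Hom s t) (B : Hom t s)
    (dX : Duality X A) (dY : Duality Y B) :
  mate (tens_duality (map_duality F dX) (map_duality F dY)) (map_duality F (tens_duality dX dY))
    (pf_mult F X Y) (bwd (pf_mult F B A)).
Proof.
rewrite /mate.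
(* All associators and unitors are collected inside the right factor of id_B ⋆ _,
   so that naturality of the multiplicator applies to that factor as a whole. *)
have -> : cup (map_duality F (tens_duality dX dY)) = bwd (pf_mult F (B ⊗ A) (X ⊗ Y)) ∘
    pf_cell F (asc' B A (X ⊗ Y) ∘ (id2 B ⋆ (asc A X Y ∘ (cup dX ⋆ id2 Y) ∘ lu' Y)) ∘ cup dY)
    ∘ pf_unit F t.
  by rewrite /=; congr (_ ∘ _ ∘ _); congr pf_cell; apply: pk_inj; pk_norm.
apply: pk_inj.
move: (f_equal (fun z => pk (z ∘ pf_cell F (asc' B A (X ⊗ Y)))) (bwd_assoc B A (X ⊗ Y)))
  (f_equal (fun z => pk (id2 (pf_hom F B) ⋆ z)) (bwd_multA A X Y))
  (f_equal (fun z => pk z) (bwd_mult_nat F (id2 B) (asc A X Y ∘ (cup dX ⋆ id2 Y) ∘ lu' Y)))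
  (f_equal (fun z => pk (id2 (pf_hom F B) ⋆ z)) (pf_mult_nat F (cup dX) (id2 Y)))
  (f_equal (fun z => pk ((id2 (pf_hom F B) ⋆ (pf_cell F (lu' Y) ∘ z ∘ lu' _)) ∘
     bwd (pf_mult F B Y))) (pf_unitL F Y)).
rewrite /= !pf_comp.
rewrite /asc /asc' /lu /lu' /ru /ru' !pf_cast !pf_id.
pk_norm => E1 E2 E3 E4 E5.
rewrite (pkv_front E1) pkvA (pkv_front (eq_sym E3)) pkvA.
by rewrite (pkv_front E2) pkvA (pkv_front E4) pkvA (pkv_front3 E5).
Qed.
End Functor.

(** * The dual of a pseudonatural transformation *)

Section DualCell.
Context (C : TwoCat) (D : PivotalTwoCat) (F G : Pseudofunctor C D).
Local Notation rd := (rd_duality (pc_duals D)).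
Local Notation "X ^*" := (rd_ob (pc_duals D) X) (at level 2, format "X ^*").

(** The component of α^* at X, computed with an arbitrary left dual A of X in
    place of the chosen one. *)
Definition dual_cell (α : PseudonatData F G) (r s : C) (X : Hom r s) (A : Hom s r) (e : Duality A X) :
    pf_hom G X ⊗ (pn_ob α s)^* ⇒ (pn_ob α r)^* ⊗ pf_hom F X :=
  rtranspose (tens_duality (map_duality F e) (rd (pn_ob α r)))
    (tens_duality (rd (pn_ob α s)) (map_duality G e)) (pn_cell α A).

Lemma dual_cell_mate (α : PseudonatData F G) (r s : C) (X : Hom r s) (A : Hom s r) (e : Duality A X) :
  mate (tens_duality (map_duality F e) (rd (pn_ob α r)))
    (tens_duality (rd (pn_ob α s)) (map_duality G e)) (pn_cell α A) (dual_cell α e).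
Proof. exact: rtranspose_mate. Qed.

Context (α : Pseudonat F G).

(** This is the mate of the naturality of α at the left transpose of v.  Besides
    the naturality of α^*, the case v = id shows that the dual component does not
    depend on the left dual. *)
Lemma dual_cell_nat (r s : C) (X Y : Hom r s) (A B : Hom s r) (e : Duality A X) (e' : Duality B Y)
    (v : X ⇒ Y) :
  (id2 (pn_ob α r)^* ⋆ pf_cell F v) ∘ dual_cell α e
  = dual_cell α e' ∘ (pf_cell G v ⋆ id2 (pn_ob α s)^*).
Proof.
have M := ltranspose_mate e' e v.
apply: (mate_eq (eq_sym (pn_nat (pn_laws α) (ltranspose e' e v)))).
- apply: mate_v; last exact: dual_cell_mate.
  by apply: mate_h; [exact: map_mate M | exact: mate_id].
- apply: mate_v; first exact: dual_cell_mate.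
  by apply: mate_h; [exact: mate_id | exact: map_mate M].
Qed.

Lemma dual_cell_iso (r s : C) (X : Hom r s) (A : Hom s r) (e : Duality A X) :
  is_iso (dual_cell α e).
Proof.
have [g [Kl Kr]] := pn_iso (pn_laws α) A.
pose i := Build_Iso2 Kl Kr.
pose j := rtranspose_iso (tens_duality (map_duality F e) (rd (pn_ob α r)))
   (tens_duality (rd (pn_ob α s)) (map_duality G e)) i.
by exists (bwd j); exact: (conj (fwdK j) (bwdK j)).
Qed.

(** Transposing the composition law of α at (B, A), with the multiplicators moved
    to the other side, since the mate of a multiplicator is the inverse of one. *)
Lemma dual_cell_tens (r s t : C) (X : Hom r s) (A : Hom s r) (eX : Duality A X)
   (Y : Hom s t) (B : Hom t s) (eY : Duality B Y) :
  dual_cell α (tens_duality eY eX) ∘ (pf_mult G X Y ⋆ id2 (pn_ob α t)^*)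
    = (id2 (pn_ob α r)^* ⋆ pf_mult F X Y)
        ∘ asc (pn_ob α r)^* (pf_hom F X) (pf_hom F Y)
        ∘ (dual_cell α eX ⋆ id2 (pf_hom F Y))
        ∘ asc' (pf_hom G X) (pn_ob α s)^* (pf_hom F Y)
        ∘ (id2 (pf_hom G X) ⋆ dual_cell α eY)
        ∘ asc (pf_hom G X) (pf_hom G Y) (pn_ob α t)^*.
Proof.
have E : (id2 (pn_ob α r)^* ⋆ bwd (pf_mult F X Y)) ∘ dual_cell α (tens_duality eY eX)
    = asc (pn_ob α r)^* (pf_hom F X) (pf_hom F Y)
      ∘ ((dual_cell α eX ⋆ id2 (pf_hom F Y))
      ∘ (asc' (pf_hom G X) (pn_ob α s)^* (pf_hom F Y)
      ∘ ((id2 (pf_hom G X) ⋆ dual_cell α eY)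
      ∘ (asc (pf_hom G X) (pf_hom G Y) (pn_ob α t)^*
      ∘ (bwd (pf_mult G X Y) ⋆ id2 (pn_ob α t)^*))))).
{ apply: (mate_eq (pn_mult (pn_laws α) B A)).
  - apply: mate_v; last exact: dual_cell_mate.
    by apply: mate_h; [exact: mate_mult | exact: mate_id].
  - apply: mate_v; first exact: mate_asc.
    apply: mate_v; first by apply: mate_h; [exact: mate_id | exact: dual_cell_mate].
    apply: mate_v; first exact: mate_asc'.
    apply: mate_v; first by apply: mate_h; [exact: dual_cell_mate | exact: mate_id].
    apply: mate_v; first exact: mate_asc.
    by apply: mate_h; [exact: mate_id | exact: mate_mult]. }
have -> : dual_cell α (tens_duality eY eX) = (id2 (pn_ob α r)^* ⋆ pf_mult F X Y) ∘
   ((id2 (pn_ob α r)^* ⋆ bwd (pf_mult F X Y)) ∘ dual_cell α (tens_duality eY eX)).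
  by rewrite vcompA -whiskerL bwdK hcomp_id vcompL.
by rewrite E -!vcompA -whiskerR fwdK hcomp_id vcompR !vcompA.
Qed.

Lemma dual_cell_id (r : C) :
  dual_cell α (id_duality r) ∘ (pf_unit G r ⋆ id2 (pn_ob α r)^*)
    = (id2 (pn_ob α r)^* ⋆ pf_unit F r) ∘ ru' (pn_ob α r)^* ∘ lu (pn_ob α r)^*.
Proof.
have E : (id2 (pn_ob α r)^* ⋆ bwd (pf_unit F r)) ∘ dual_cell α (id_duality r) =
   ru' (pn_ob α r)^* ∘ (lu (pn_ob α r)^* ∘ (bwd (pf_unit G r) ⋆ id2 (pn_ob α r)^*)).
{ apply: (mate_eq (pn_unit (pn_laws α) r)).
  - apply: mate_v; last exact: dual_cell_mate.
    by apply: mate_h; [exact: mate_unit | exact: mate_id].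
  - apply: mate_v; first exact: mate_lu.
    apply: mate_v; first exact: mate_ru'.
    by apply: mate_h; [exact: mate_id | exact: mate_unit]. }
have -> : dual_cell α (id_duality r) = (id2 (pn_ob α r)^* ⋆ pf_unit F r) ∘
   ((id2 (pn_ob α r)^* ⋆ bwd (pf_unit F r)) ∘ dual_cell α (id_duality r)).
  by rewrite vcompA -whiskerL bwdK hcomp_id vcompL.
by rewrite E -!vcompA -whiskerR fwdK hcomp_id vcompR !vcompA.
Qed.

(** Naturality of α at the cup of e, with the components of α at A ⊗ X and at the
    identity expressed by its composition and unit laws. *)
Lemma pn_cup (r s : C) (X : Hom r s) (A : Hom s r) (e : Duality X A) :
  asc _ _ _ ∘ (pn_cell α A ⋆ id2 (pf_hom G X)) ∘ asc' _ _ _ ∘ (id2 (pf_hom F A) ⋆ pn_cell α X) ∘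
    asc _ _ _ ∘ (cup (map_duality F e) ⋆ id2 (pn_ob α s))
  = (id2 (pn_ob α s) ⋆ cup (map_duality G e)) ∘ ru' (pn_ob α s) ∘ lu (pn_ob α s).
Proof.
apply: pk_inj.
move: (f_equal (fun z => pk z) (pn_mult (pn_laws α) A X))
  (f_equal (fun z => pk z) (pn_unit (pn_laws α) s))
  (f_equal (fun z => pk z) (pn_nat (pn_laws α) (cup e)))
  (f_equal (fun z => pk ((id2 (pn_ob α s) ⋆ z) ∘ asc _ _ _ ∘ (pn_cell α A ⋆ id2 (pf_hom G X))))
     (fwdK (pf_mult G A X)))
  (f_equal (fun z => pk ((z ∘ pf_cell F (cup e) ∘ pf_unit F s) ⋆ id2 (pn_ob α s)))
     (bwdK (pf_mult F A X))).
rewrite /=.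
pk_norm => E1 E2 E3 E4 E5.
by rewrite -E2 (pkv_front E3) pkvA -E5 (pkv_front E1) !pkvA (pkv_front3 E4) E5.
Qed.

Lemma pn_cap (r s : C) (X : Hom r s) (A : Hom s r) (e : Duality X A) :
  (id2 (pn_ob α r) ⋆ cap (map_duality G e)) ∘ asc _ _ _ ∘ (pn_cell α X ⋆ id2 (pf_hom G A)) ∘
    asc' _ _ _ ∘ (id2 (pf_hom F X) ⋆ pn_cell α A)
  = ru' (pn_ob α r) ∘ lu (pn_ob α r) ∘ (cap (map_duality F e) ⋆ id2 (pn_ob α r)) ∘ asc' _ _ _.
Proof.
apply: pk_inj.
move: (f_equal (fun z => pk z) (pn_mult (pn_laws α) X A))
  (f_equal (fun z => pk z) (pn_unit (pn_laws α) r))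
  (f_equal (fun z => pk z) (pn_nat (pn_laws α) (cap e)))
  (f_equal (fun z => pk ((id2 (pn_ob α r) ⋆ z) ∘ ru' _ ∘ lu _ ∘ (bwd (pf_unit F r) ⋆ id2 _)))
     (fwdK (pf_unit G r)))
  (f_equal (fun z => pk ((z ∘ pf_cell F (cap e) ∘ pf_mult F X A) ⋆ id2 (pn_ob α r)))
     (bwdK (pf_unit F r))).
rewrite /=.
pk_norm => E1 E2 E3 E4 E5.
by rewrite -E1 (pkv_front E3) pkvA -E5 (pkv_front E2) (pkv_front3 E4) E5.
Qed.

(** Bending the strand G(X) with the cup of its left dual turns the dual component
    into α_A, by the mate relation; what remains is the naturality of α at the cup
    of e. *)
Lemma dual_cell_cup (r s : C) (X : Hom r s) (A : Hom s r) (e : Duality A X) :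
  asc' _ _ _ ∘ (id2 (pn_ob α r)^* ⋆ pn_cell α X) ∘ asc _ _ _ ∘ (dual_cell α e ⋆ id2 (pn_ob α s))
   ∘ asc' _ _ _ ∘ (id2 (pf_hom G X) ⋆ cup (rd (pn_ob α s)))
  = (cup (rd (pn_ob α r)) ⋆ id2 (pf_hom G X)) ∘ (lu' (pf_hom G X) ∘ ru (pf_hom G X)).
Proof.
suff H : asc' _ _ _ ∘ (id2 (pn_ob α r)^* ⋆ pn_cell α X) ∘ asc _ _ _
   ∘ (dual_cell α e ⋆ id2 (pn_ob α s))
   ∘ asc' _ _ _ ∘ (id2 (pf_hom G X) ⋆ cup (rd (pn_ob α s))) ∘ ru' (pf_hom G X)
  = (cup (rd (pn_ob α r)) ⋆ id2 (pf_hom G X)) ∘ lu' (pf_hom G X).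
  by move: (dual_cell α e) H => d' /(f_equal (fun z => pk z)); pk_norm => H; apply: pk_inj; pk_norm.
apply: (cup_inj (e := map_duality G e)); apply: pk_inj.
move: (f_equal (fun z => pk z) (dual_cell_mate α e))
  (f_equal (fun z => pk (id2 (pn_ob α r)^* ⋆ z)) (pn_cup e))
  (f_equal (fun z => pk z) (slide (cup (rd (pn_ob α r))) (cup (map_duality G e)))).
move: (dual_cell α e) (map_duality F e) (map_duality G e) => d' dF dG /=.
by pk_norm => E1 E2 E3; rewrite -E1 (pkv_front3 E2) E3.
Qed.

Lemma dual_cell_cap (r s : C) (X : Hom r s) (A : Hom s r) (e : Duality A X) :
  (lu' (pf_hom F X) ∘ ru (pf_hom F X)) ∘ (id2 (pf_hom F X) ⋆ cap (rd (pn_ob α s)))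
  = (cap (rd (pn_ob α r)) ⋆ id2 (pf_hom F X)) ∘
   (asc' _ _ _ ∘ (id2 (pn_ob α r) ⋆ dual_cell α e) ∘ asc _ _ _ ∘ (pn_cell α X ⋆ id2 (pn_ob α s)^*)
   ∘ asc' _ _ _).
Proof.
suff H : ru (pf_hom F X) ∘ (id2 (pf_hom F X) ⋆ cap (rd (pn_ob α s)))
  = lu (pf_hom F X) ∘ ((cap (rd (pn_ob α r)) ⋆ id2 (pf_hom F X)) ∘
   (asc' _ _ _ ∘ (id2 (pn_ob α r) ⋆ dual_cell α e) ∘ asc _ _ _ ∘ (pn_cell α X ⋆ id2 (pn_ob α s)^*)
   ∘ asc' _ _ _)).
  by move: (dual_cell α e) H => d' /(f_equal (fun z => pk z)); pk_norm => H; apply: pk_inj; pk_norm.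
apply: (cap_inj (e := map_duality F e)); apply: pk_inj.
move: (f_equal (fun z => pk z) (cap_mate (dual_cell_mate α e)))
  (f_equal (fun z => pk (z ⋆ id2 (pn_ob α s)^* )) (pn_cap e))
  (f_equal (fun z => pk z) (slide (cap (map_duality F e)) (cap (rd (pn_ob α s))))).
move: (dual_cell α e) (map_duality F e) (map_duality G e) => d' dF dG /=.
by pk_norm => E1 E2 E3; rewrite (pkv_front3 (eq_sym E1)) !pkvA E2 E3.
Qed.
End DualCell.

(** * Pivotal comparison of a 1-morphism with a double dual *)

Section Pivotal.
Context (C : PivotalTwoCat).
Local Notation rd := (rd_duality (pc_duals C)).
Local Notation "X ^*" := (rd_ob (pc_duals C) X) (at level 2, format "X ^*").
Local Notation ι := (iota (pc_pivotal C)).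
Local Notation ld := ld_duality.

(** k compares the right dual A with X^*; its transpose compares X' with X, as
    right duals of A and X^*, where X is right dual to X^* through ι_X.  For
    the chosen duals this is the inverse of ι_X. *)
Definition pivot (r s : C) (X : Hom r s) (A : Hom s r) (X' : Hom r s)
    (dX : Duality X A) (dA : Duality A X') (i : X ⇒ X') : Prop :=
  exists k : A ⇒ X^*, mate (rd X) dX (id2 X) k /\ mate dA (ld X) k i.

Lemma rd_cell_mate (r s : C) (X Y : Hom r s) (f : X ⇒ Y) :
  mate (rd X) (rd Y) f (rd_cell (pc_duals C) f).
Proof. exact: rtranspose_mate. Qed.

(** X is right dual to X^* through ι_X, and with respect to these duals a second
    transpose of f gives back f: this is the naturality of ι. *)
Lemma ld_mate (r s : C) (X Y : Hom r s) (f : X ⇒ Y) :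
  mate (ld Y) (ld X) (rd_cell (pc_duals C) f) f.
Proof.
have [Hn _] := proj1 (icon_dataP _) (iota_icon (pc_pivotal C)).
have M := mate_v (mate_v (mate_unshift _ (ι Y)) (rtranspose_mate (rd Y^*) (rd X^*)
  (rd_cell (pc_duals C) f))) (mate_shift _ (ι X)).
move: M; rewrite vcompL vcompR -(Hn _ _ X Y f).
by rewrite -vcompA bwdK vcompR.
Qed.

(** Comparing A and B with X^* and Y^* turns g into the chosen transpose f^*, whose
    transpose is f by [ld_mate]. *)
Lemma pivot_nat (r s : C) (X Y : Hom r s) (A B : Hom s r) (X' Y' : Hom r s)
    (dX : Duality X A) (dA : Duality A X') (i : X ⇒ X')
    (dY : Duality Y B) (dB : Duality B Y') (j : Y ⇒ Y')
    (f : X ⇒ Y) (g : B ⇒ A) (h : X' ⇒ Y') :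
  pivot dX dA i -> pivot dY dB j -> mate dX dY f g -> mate dB dA g h -> h ∘ i = j ∘ f.
Proof.
move=> [k [Mk Ni]] [l [Ml Nj]] Mf Mg.
have E : k ∘ g = rd_cell (pc_duals C) f ∘ l.
  apply: (mate_eq _ (mate_v Mk Mf) (mate_v (rd_cell_mate f) Ml)).
  by rewrite vcompL vcompR.
apply: (mate_eq E); first by apply: mate_v; [exact: Mg | exact: Ni].
by apply: mate_v; [exact: Nj | exact: ld_mate].
Qed.

Lemma pivot_rd (r s : C) (X : Hom r s) : pivot (rd X) (rd X^*) (bwd (ι X)).
Proof. by exists (id2 X^*); split; [exact: mate_id | exact: mate_shift]. Qed.

(** The transpose of [rd_mult] is [dd_mult] for the chosen duals, and ι turns it
    into an identity. *)
Lemma ld_mult_mate (r s t : C) (X : Hom r s) (Y : Hom s t) :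
  mate (ld (X ⊗ Y)) (tens_duality (ld Y) (ld X)) (rd_mult (pc_duals C) X Y) (id2 (X ⊗ Y)).
Proof.
have [_ [Hm _]] := proj1 (icon_dataP _) (iota_icon (pc_pivotal C)).
have M := mate_v (mate_v (mate_unshift _ (ι (X ⊗ Y)))
    (rtranspose_mate (rd (X ⊗ Y)^*) (tens_duality (rd Y^*) (rd X^*)) (rd_mult (pc_duals C) X Y)))
  (mate_h (mate_shift _ (ι Y)) (mate_shift _ (ι X))).
move: M; rewrite vcompR hcomp_id vcompL (Hm _ _ _ X Y).
by rewrite -interchange !bwdK hcomp_id.
Qed.

Lemma ld_unit_mate (r : C) :
  mate (ld (id1 r)) (id_duality r) (rd_unit (pc_duals C) r) (id2 (id1 r)).
Proof.
have [_ [_ Hu]] := proj1 (icon_dataP _) (iota_icon (pc_pivotal C)).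
have M := mate_v (mate_unshift _ (ι (id1 r)))
    (rtranspose_mate (rd (id1 r)^*) (id_duality r) (rd_unit (pc_duals C) r)).
by move: M; rewrite vcompR (Hu r).
Qed.

(** The comparison of B ⊗ A with (X ⊗ Y)^* is the product of the two given ones,
    followed by the inverse of [rd_mult]; the latter transposes to an identity by
    [ld_mult_mate]. *)
Lemma pivot_tens (r s t : C) (X : Hom r s) (A : Hom s r) (X' : Hom r s)
    (Y : Hom s t) (B : Hom t s) (Y' : Hom s t)
    (dX : Duality X A) (dA : Duality A X') (i : X ⇒ X')
    (dY : Duality Y B) (dB : Duality B Y') (j : Y ⇒ Y') :
  pivot dX dA i -> pivot dY dB j ->
  pivot (tens_duality dX dY) (tens_duality dB dA) (i ⋆ j).
Proof.
move=> [k [Mk Ni]] [l [Ml Nj]].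
exists (bwd (rd_mult (pc_duals C) X Y) ∘ (l ⋆ k)); split.
- have M := mate_inv (f := iso_id (X ⊗ Y)) (rcompare_mate (rd (X ⊗ Y)) (tens_duality (rd X) (rd Y))).
  by have := mate_v M (mate_h Mk Ml); rewrite hcomp_id vcompL.
- rewrite -(vcompR (i ⋆ j)).
  apply: mate_v; first exact: mate_h Nj Ni.
  exact: (mate_inv (g := iso_id (X ⊗ Y))) (ld_mult_mate X Y).
Qed.

Lemma pivot_id (r : C) : pivot (id_duality r) (id_duality r) (id2 (id1 r)).
Proof.
exists (bwd (rd_unit (pc_duals C) r)); split.
- exact: (mate_inv (f := iso_id (id1 r))) (rcompare_mate (rd (id1 r)) (id_duality r)).
- exact: (mate_inv (g := iso_id (id1 r))) (ld_unit_mate r).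
Qed.

(** Equivalently ι_(X^* ) is the inverse of the transpose of ι_X.  The cup of X
    has as second transpose the cup of X^**, so [pivot_nat] relates the two cups by
    ι_(X^* ) and ι_X. *)
Lemma ld_rd_mate (r s : C) (X : Hom r s) : mate (ld X^*) (rd X) (ι X) (id2 X^*).
Proof.
have E : cup (rd X^*^*) = (bwd (ι X^*) ⋆ bwd (ι X)) ∘ cup (rd X).
  rewrite -[LHS]vcompR.
  apply: pivot_nat; [exact: pivot_id|apply: pivot_tens; exact: pivot_rd|exact: mate_cup|exact: mate_cap].
rewrite /mate /= hcomp_id vcompL E.
rewrite !vcompA -!interchange vcompL bwdK vcompR bwdK.
by rewrite hcomp_id vcompL.
Qed.

(** The object X may be replaced by another left dual of A: the comparison 2-morphism
    φ and its transpose are absorbed into i and k. *)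
Lemma pivot_retarget (r s : C) (X W : Hom r s) (A : Hom s r) (X' : Hom r s)
    (dX : Duality X A) (dW : Duality W A) (dA : Duality A X') (i : X ⇒ X') (φ : Iso2 W X) :
  mate dW dX φ (id2 A) -> pivot dX dA i -> pivot dW dA (i ∘ φ).
Proof.
move=> M [k [Mk Ni]]; exists (rd_cell (pc_duals C) φ ∘ k); split.
- have := mate_v (mate_v (rd_cell_mate φ) Mk) (mate_inv (g := iso_id A) M).
  by rewrite vcompL vcompR fwdK.
- by apply: mate_v; [exact: Ni | exact: ld_mate].
Qed.
End Pivotal.

Section PivotalFunctor.
Context (C D : PivotalTwoCat) (F : Pseudofunctor C D) (pF : pf_pivotal F).

(** F_r satisfies the mate relation with the chosen right duals by definition, and
    F_l the one with the left duals; F_l = F_r is the witness that satisfies both. *)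
Lemma pf_pivot (r s : C) (X : Hom r s) :
  pivot (map_duality F (rd_duality (pc_duals C) X)) (map_duality F (ld_duality X)) (id2 (pf_hom F X)).
Proof.
exists (pf_right F X); split; first exact: rcompare_mate.
have [E _] := proj1 (lcompareP _ _ _) (eq_sym (pF X)).
by rewrite /mate E hcomp_id vcompL.
Qed.

(** [ld_rd_mate], carried along F, exchanges F(X) for F(X^** ) in [pf_pivot]. *)
Lemma pf_pivot_ld (r s : C) (X : Hom r s) :
  pivot (map_duality F (ld_duality (rd_ob (pc_duals C) X))) (map_duality F (ld_duality X))
    (pf_cell F (iota (pc_pivotal C) X)).
Proof.
have M := map_mate F (ld_rd_mate X); rewrite pf_id in M.
have := pivot_retarget (φ := pf_iso F (iota (pc_pivotal C) X)) M (pf_pivot X).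
by rewrite vcompL.
Qed.
End PivotalFunctor.

(** * Dual laws and the pivotal modification *)

Section Laws.
Context (C D : PivotalTwoCat).

(** The chosen left duals of X ⊗ Y and of an identity need not be the composite and
    the identity duality; [dual_cell_nat] at an identity 2-morphism exchanges
    them. *)
Lemma pn_dual_laws (F G : Pseudofunctor C D) (α : Pseudonat F G) : IsPseudonat (pn_dual_data α).
Proof.
split.
- by move=> r s X; exact: (dual_cell_iso α (ld_duality X)).
- by move=> r s X Y f; exact: (dual_cell_nat α (ld_duality X) (ld_duality Y) f).
- move=> r s t X Y; rewrite -[RHS](dual_cell_tens α (ld_duality X) (ld_duality Y)).
  congr (_ ∘ _).
  have := dual_cell_nat α (ld_duality (X ⊗ Y)) (tens_duality (ld_duality Y) (ld_duality X)) (id2 _).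
  by rewrite !pf_id !hcomp_id vcompL vcompR.
- move=> r; rewrite -[RHS](dual_cell_id α r); congr (_ ∘ _).
  have := dual_cell_nat α (ld_duality (id1 r)) (id_duality r) (id2 _).
  by rewrite !pf_id !hcomp_id vcompL vcompR.
Qed.

Lemma fun_dual_laws : FunDualLaws C D.
Proof.
split=> F G _ _ α; first exact: pn_dual_laws.
- by move=> r s X; exact: (dual_cell_cup α (ld_duality X)).
- by move=> r s X; exact: (dual_cell_cap α (ld_duality X)).
Qed.

(** The component of α^** at X is a double mate of α at X^**, so it is related to
    α_(X^** ) by ι in D on the α_r and by F(ι_X), G(ι_X).  Naturality of α at ι_X
    replaces α_(X^** ) by α_X, and F(ι_X) cancels. *)
Lemma iota_modification (F G : Pseudofunctor C D) (α : Pseudonat F G) :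
  pf_pivotal F -> pf_pivotal G ->
  IsModification (α := pn_dual_data (pn_dual_data α)) (β := α)
    (fun r => fwd (iota (pc_pivotal D) (pn_ob α r))).
Proof.
move=> pF pG r s X /=.
set a := rtranspose _ _ _; pose ιX := iota (pc_pivotal C) X.
pose ιr := iota (pc_pivotal D) (pn_ob α r); pose ιs := iota (pc_pivotal D) (pn_ob α s).
have N := pn_nat (pn_laws α) ιX.
have E : a ∘ (pf_cell F ιX ⋆ bwd ιs) = (bwd ιr ⋆ pf_cell G ιX) ∘ pn_cell α _.
  have P := pivot_tens (pf_pivot_ld pF X) (pivot_rd (pn_ob α s)).
  have Q := pivot_tens (pivot_rd (pn_ob α r)) (pf_pivot_ld pG X).
  by apply: (pivot_nat P Q); exact: rtranspose_mate.
(* As a variable, a stays one factor when composites are reassociated below. *)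
move: a E => a E.
(* Both sides may be compared after the invertible F(ι_X) ⋆ ι_(α_s)⁻¹. *)
have K c : c = c ∘ (pf_cell F ιX ⋆ bwd ιs) ∘ (pf_cell F (bwd ιX) ⋆ ιs).
  by rewrite -vcompA -interchange -pf_comp !bwdK fwdK pf_id hcomp_id vcompR.
rewrite [LHS]K [RHS]K; congr (_ ∘ _).
rewrite -!vcompA E -interchange vcompL bwdK -N.
by rewrite vcompA -interchange vcompL bwdK.
Qed.
End Laws.

(** * Componentwise computation of the double dual *)

Section FunPivotal.
Context (C D : PivotalTwoCat) (L : FunDualLaws C D).
Local Notation R := (fun_p_duals L).

(** The relation of mates depends on the dualities only through their cups, which
    is why only these are matched with those of D. *)
Lemma eval_mate (F G : Fun_p C D) (α β : Hom F G) (α' β' : Hom G F)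
    (dα : Duality α α') (dβ : Duality β β') (f : α ⇒ β) (g : β' ⇒ α') (r : C)
    (d : Duality (pn_ob α r) (pn_ob α' r)) (d' : Duality (pn_ob β r) (pn_ob β' r)) :
  cup d = md_cell (cup dα) r -> cup d' = md_cell (cup dβ) r ->
  mate dα dβ f g -> mate d d' (md_cell f r) (md_cell g r).
Proof.
by rewrite /mate => -> -> M; exact: (f_equal (fun m => md_cell m r) M).
Qed.

Lemma eval_tens_cup (F G H : Fun_p C D) (α : Hom F G) (α' : Hom G F) (β : Hom G H) (β' : Hom H G)
    (dα : Duality α α') (dβ : Duality β β') (r : C)
    (d : Duality (pn_ob α r) (pn_ob α' r)) (d' : Duality (pn_ob β r) (pn_ob β' r)) :
  cup d = md_cell (cup dα) r -> cup d' = md_cell (cup dβ) r ->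
  cup (tens_duality d d') = md_cell (cup (tens_duality dα dβ)) r.
Proof.
move=> E E'; rewrite /= E E' !md_cast_p.
by congr (_ ∘ (_ ⋆ _) ∘ _ ∘ (_ ⋆ _) ∘ _); apply: cast_irr.
Qed.

Lemma eval_id_cup (F : Fun_p C D) (r : C) :
  cup (id_duality (proj1_sig F r)) = md_cell (cup (id_duality F)) r.
Proof. by rewrite /= /lu' md_cast_p; apply: cast_irr. Qed.

Lemma eval_rd_cell (F G : Fun_p C D) (α β : Hom F G) (f : α ⇒ β) (r : C) :
  md_cell (rd_cell R f) r = rd_cell (pc_duals D) (md_cell f r).
Proof.
apply: mate_inj; last exact: rtranspose_mate.
by apply: (eval_mate _ _ (rtranspose_mate (rd_duality R α) (rd_duality R β) f)).
Qed.

Lemma eval_rd_mult (F G H : Fun_p C D) (α : Hom F G) (β : Hom G H) (r : C) :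
  md_cell (fwd (rd_mult R α β)) r = rd_mult (pc_duals D) (pn_ob α r) (pn_ob β r).
Proof.
apply: mate_inj; last exact: rcompare_mate.
apply: (eval_mate _ _ (rcompare_mate (rd_duality R (α ⊗ β))
  (tens_duality (rd_duality R α) (rd_duality R β)))); last by [].
exact: eval_tens_cup.
Qed.

Lemma eval_dd_mult (F G H : Fun_p C D) (α : Hom F G) (β : Hom G H) (r : C) :
  md_cell (fwd (dd_mult R α β)) r = dd_mult (pc_duals D) (pn_ob α r) (pn_ob β r).
Proof.
apply: mate_inj; last exact: rtranspose_mate.
rewrite -eval_rd_mult.
apply: (eval_mate _ _ (rtranspose_mate (rd_duality R (rd_ob R (α ⊗ β)))
  (tens_duality (rd_duality R (rd_ob R β)) (rd_duality R (rd_ob R α))) (rd_mult R α β))); first by [].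
exact: eval_tens_cup.
Qed.

Lemma eval_rd_unit (F : Fun_p C D) (r : C) :
  md_cell (fwd (rd_unit R F)) r = rd_unit (pc_duals D) (proj1_sig F r).
Proof.
apply: mate_inj; last exact: rcompare_mate.
apply: (eval_mate _ _ (rcompare_mate (rd_duality R (id1 F)) (id_duality F))); last by [].
exact: eval_id_cup.
Qed.

Lemma eval_dd_unit (F : Fun_p C D) (r : C) :
  md_cell (fwd (dd_unit R F)) r = dd_unit (pc_duals D) (proj1_sig F r).
Proof.
apply: mate_inj; last exact: rtranspose_mate.
rewrite -eval_rd_unit.
apply: (eval_mate _ _ (rtranspose_mate (rd_duality R (rd_ob R (id1 F))) (id_duality F)
  (rd_unit R F))); first by [].
exact: eval_id_cup.
Qed.

Lemma bwd_modification (F G : Pseudofunctor C D) (α β : PseudonatData F G)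
    (i : forall r, Iso2 (pn_ob α r) (pn_ob β r)) :
  IsModification (fun r => fwd (i r)) -> IsModification (fun r => bwd (i r)).
Proof.
move=> M r s X.
rewrite -[LHS]vcompL -hcomp_id -(fwdK (i r)) whiskerR -!vcompA; congr (_ ∘ _).
by rewrite vcompA -M -vcompA -whiskerL bwdK hcomp_id vcompR.
Qed.

Definition iota_md (F G : Fun_p C D) (α : Hom F G) : rd_ob R (rd_ob R α) ⇒ α :=
  Build_Modification (α := rd_ob R (rd_ob R α)) (β := α)
    (iota_modification α (proj2_sig F) (proj2_sig G)).

Definition iota_md_inv (F G : Fun_p C D) (α : Hom F G) : α ⇒ rd_ob R (rd_ob R α) :=
  Build_Modification (α := α) (β := rd_ob R (rd_ob R α))
    (bwd_modification (iota_modification α (proj2_sig F) (proj2_sig G))).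

Definition iota_hat (F G : Fun_p C D) (α : Hom F G) : Iso2 (rd_ob R (rd_ob R α)) α.
Proof.
exists (iota_md α) (iota_md_inv α).
- abstract (by apply: modification_eq => r; exact: fwdK).
- abstract (by apply: modification_eq => r; exact: bwdK).
Defined.

Lemma iota_hat_icon : IsPseudonat (icon_data iota_hat).
Proof.
have [Hn [Hm Hu]] := proj1 (icon_dataP _) (iota_icon (pc_pivotal D)).
apply/icon_dataP; split; last split.
- move=> F G α β f; apply: modification_eq => r.
  rewrite -[LHS]/(md_cell f r ∘ iota (pc_pivotal D) (pn_ob α r)).
  rewrite -[RHS]/(iota (pc_pivotal D) (pn_ob β r) ∘ md_cell (rd_cell R (rd_cell R f)) r).
  by rewrite !eval_rd_cell; exact: Hn.
- move=> F G H α β; apply: modification_eq => r.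
  by have := Hm _ _ _ (pn_ob α r) (pn_ob β r); rewrite -eval_dd_mult.
- move=> F; apply: modification_eq => r.
  by have := Hu (proj1_sig F r); rewrite -eval_dd_unit.
Qed.

Definition fun_p_pivotal : PivotalStructure R := {| iota_icon := iota_hat_icon |}.
End FunPivotal.

Theorem proposition3p6 (C D : PivotalTwoCat) :
  exists (L : FunDualLaws C D) (ι : PivotalStructure (fun_p_duals L)),
    forall (F G : Fun_p C D) (α : Hom F G) (r : C),
      md_cell (fwd (iota ι α)) r = fwd (iota (pc_pivotal D) (pn_ob α r)).
Proof. by exists (fun_dual_laws C D), (fun_p_pivotal (fun_dual_laws C D)). Qed.
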